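(* For every $1 < p < \infty$ there exists a non-subprojective Banach space $Z_p$ containing a subspace $X_p$ such that both $X_p$ and the quotient $Z_p/X_p$ are isomorphic to $\ell_p$.
   Context: Subspaces are closed and infinite dimensional. A Banach space $X$ is subprojective if every closed infinite dimensional subspace $Y \subset X$ contains a closed infinite dimensional subspace $Z \subset Y$ that is complemented in $X$. ''Isomorphic'' means linearly homeomorphic. *)

(* Defs.v *)
From HB Require Import structures.
From mathcomp Require Import all_boot all_order all_algebra.
From mathcomp Require Import ring_quotient generic_quotient.
From mathcomp Require Import complex.
From mathcomp Require Import all_classical all_reals all_analysis.

Set Implicit Arguments.
Unset Strict Implicit.
Unset Printing Implicit Defensive.

Import Order.TTheory GRing.Theory Num.Theory.
Import numFieldNormedType.Exports.

Local Open Scope classical_set_scope.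
Local Open Scope ring_scope.

(* Banach spaces are taken over the real or the complex numbers, so every notion
   below is parameterized by the choice of one of these two scalar fields. *)
Variant scalar_kind := RealScalars | ComplexScalars.

Definition scalars (R : realType) (F : scalar_kind) : numFieldType :=
  match F with RealScalars => R | ComplexScalars => R[i] end.

Definition to_real (R : realType) (F : scalar_kind) : scalars R F -> R :=
  match F with
  | RealScalars => fun x => x
  | ComplexScalars => fun z => complex.Re z
  end.

Definition of_real (R : realType) (F : scalar_kind) : R -> scalars R F :=
  match F with
  | RealScalars => fun x => x
  | ComplexScalars => fun x => x%:C%C
  end.

Section Scalars.
Context {R : realType} {F : scalar_kind}.
Local Notation K := (scalars R F).
Implicit Types a b : R.

Lemma of_realK : cancel (@of_real R F) (@to_real R F).
Proof. by case: F. Qed.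

Lemma to_realK (x : K) : 0 <= x -> of_real F (to_real x) = x.
Proof.
case: F x => //= x; case: x => [a b]; rewrite lecE /= => /andP[/eqP -> _].
by [].
Qed.

Lemma of_realD a b : of_real F (a + b) = of_real F a + of_real F b.
Proof. by case: F => //=; rewrite rmorphD. Qed.

Lemma ltr_of_real a b : (of_real F a < of_real F b) = (a < b).
Proof. by case: F => //=; rewrite ltcR. Qed.

Lemma of_realM a b : of_real F (a * b) = of_real F a * of_real F b.
Proof. by case: F => //=; rewrite rmorphM. Qed.

Lemma of_real0 : of_real F 0 = 0 :> K.
Proof. by case: F. Qed.

Lemma of_real1 : of_real F 1 = 1 :> K.
Proof. by case: F. Qed.

Lemma ler_of_real a b : (of_real F a <= of_real F b) = (a <= b).
Proof. by case: F => //=; rewrite lecR. Qed.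

(* The library norm of a K-module takes its values in K; rnorm is the same
   number, read in R. *)
Definition rnorm (V : normedZmodType K) (x : V) : R := to_real `|x|.

Section Rnorm.
Context {V : normedZmodType K}.
Implicit Types x y : V.

Lemma of_real_rnorm x : of_real F (rnorm x) = `|x|.
Proof. by rewrite to_realK. Qed.

Lemma rnorm_ge0 x : 0 <= rnorm x.
Proof. by rewrite -ler_of_real of_real_rnorm of_real0. Qed.

Lemma ler_rnormD x y : rnorm (x + y) <= rnorm x + rnorm y.
Proof. by rewrite -ler_of_real of_realD !of_real_rnorm ler_normD. Qed.

Lemma rnorm0_eq0 x : rnorm x = 0 -> x = 0.
Proof.
by move=> x0; apply: normr0_eq0; rewrite -of_real_rnorm x0 of_real0.
Qed.

End Rnorm.

Lemma rnormM (x y : K) : rnorm (x * y) = rnorm x * rnorm y.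
Proof.
by apply: (can_inj of_realK); rewrite of_realM !of_real_rnorm normrM.
Qed.

Lemma rnormZ (V : normedModType K) (l : K) (x : V) :
  rnorm (l *: x) = rnorm l * rnorm x.
Proof.
by apply: (can_inj of_realK); rewrite of_realM !of_real_rnorm normrZ.
Qed.

End Scalars.

Section SequenceSpaces.
Context {R : realType} (F : scalar_kind).
Local Notation K := (scalars R F).

Definition lp_enorm (p : R) (x : nat -> K) : \bar R :=
  ('N[counting]_p%:E [EFin \o (fun n => rnorm (x n))])%E.

(* The unused proof of 1 <= p lets instance inference find the closure
   properties, which rest on Minkowski's inequality. *)
Definition lp_pred (p : R) (_ : 1 <= p) : {pred nat -> K} :=
  [pred x | (lp_enorm p x < +oo)%E].

Variables (p : R) (p1 : 1 <= p).

Lemma lp_predE (x : nat -> K) : (x \in lp_pred p1) = (lp_enorm p x < +oo)%E.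
Proof. by []. Qed.

Lemma lp_enorm_ge0 (x : nat -> K) : (0 <= lp_enorm p x)%E.
Proof. exact: Lnorm_ge0. Qed.

Let p_gt0 : 0 < p. Proof. exact: lt_le_trans p1. Qed.

Lemma lp_enormE (x : nat -> K) :
  lp_enorm p x = ((\sum_(n <oo) ((rnorm (x n)) `^ p)%:E) `^ p^-1)%E.
Proof.
rewrite /lp_enorm Lnorm_counting//; congr (_ `^ _)%E.
apply: eq_eseriesr => n _; rewrite abse_EFin ger0_norm ?rnorm_ge0//.
Qed.

Lemma lp_enormD (x y : nat -> K) :
  (lp_enorm p (x + y)%R <= lp_enorm p x + lp_enorm p y)%E.
Proof.
apply: (@le_trans _ _
  ('N[counting]_p%:E [EFin \o ((fun n => rnorm (x n)) \+ (fun n => rnorm (y n)))%R])%E).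
  rewrite lp_enormE Lnorm_counting//; apply: gt0_ler_poweR.
  - by rewrite invr_ge0 ltW.
  - by rewrite in_itv/= leey andbT nneseries_ge0// => n _ _; rewrite lee_fin powR_ge0.
  - by rewrite in_itv/= leey andbT nneseries_ge0// => n _ _; rewrite poweR_ge0.
  apply: lee_nneseries => n _ //=.
    by rewrite lee_fin powR_ge0.
  rewrite lee_fin ger0_norm ?addr_ge0 ?rnorm_ge0//.
  by rewrite ge0_ler_powR ?nnegrE ?addr_ge0 ?rnorm_ge0 ?ler_rnormD// ltW.
exact: eminkowski.
Qed.

Lemma lp_enormZ (l : K) (x : nat -> K) :
  lp_enorm p (l *: x) = ((rnorm l)%:E * lp_enorm p x)%E.
Proof.
rewrite !lp_enormE.
under eq_eseriesr do rewrite (rnormZ l) powRM ?rnorm_ge0// EFinM.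
rewrite nneseriesZl; last by move=> n _; rewrite lee_fin powR_ge0.
rewrite poweRM ?lee_fin ?powR_ge0//; last first.
  by apply: nneseries_ge0 => n _ _; rewrite lee_fin powR_ge0.
by rewrite poweR_EFin -powRrM mulfV ?gt_eqF// powRr1 ?rnorm_ge0.
Qed.

Lemma lp_enorm0_eq0 (x : nat -> K) : lp_enorm p x = 0%E -> x = 0.
Proof.
pose a n := ((rnorm (x n) `^ p)%:E)%E.
have a0 n : (0 <= a n)%E by rewrite lee_fin powR_ge0.
rewrite lp_enormE => /poweR_eq0_eq0 s0.
have {}s0 : (\sum_(n <oo) a n = 0)%E.
  by apply: s0; apply: nneseries_ge0 => k _ _; exact: a0.
apply/funext => n; apply: rnorm0_eq0; apply/eqP.
suff : (a n == 0)%E by rewrite eqe powR_eq0 => /andP[].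
rewrite eq_le a0 andbT -s0 (nneseriesD1 (n := n) (fun k _ => a0 k))//.
by rewrite leeDl// nneseries_ge0// => k _ _; exact: a0.
Qed.

Lemma lp_submod_closed : submod_closed (lp_pred p1).
Proof.
split.
  rewrite lp_predE -(scale0r (0 : nat -> K)) lp_enormZ.
  by rewrite /rnorm normr0 -of_real0 of_realK mul0e.
move=> l x y; rewrite !lp_predE => xoo yoo.
apply: le_lt_trans (lp_enormD _ _) _.
rewrite lp_enormZ lte_add_pinfty// lte_mul_pinfty// ?lee_fin ?rnorm_ge0//.
Qed.

HB.instance Definition _ :=
  GRing.isSubmodClosed.Build K (nat -> K) (lp_pred p1) lp_submod_closed.

Record lp : Type := Lp { lp_seq :> nat -> K; lp_seqP : lp_seq \in lp_pred p1 }.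

HB.instance Definition _ := [isSub for lp_seq].
HB.instance Definition _ := [Choice of lp by <:].
HB.instance Definition _ := [SubChoice_isSubLmodule of lp by <:].

Definition lp_norm (x : lp) : R := fine (lp_enorm p x).

Lemma lp_normE (x : lp) : (lp_norm x)%:E = lp_enorm p x.
Proof.
by rewrite fineK// ge0_fin_numE ?lp_enorm_ge0// -lp_predE lp_seqP.
Qed.

Let lp_normD (x y : lp) :
  of_real F (lp_norm (x + y)) <= of_real F (lp_norm x) + of_real F (lp_norm y).
Proof.
by rewrite -of_realD ler_of_real -lee_fin EFinD !lp_normE lp_enormD.
Qed.

Let lp_normZ (l : K) (x : lp) :
  of_real F (lp_norm (l *: x)) = `|l| * of_real F (lp_norm x).
Proof.
rewrite -of_real_rnorm -of_realM; congr of_real; apply: EFin_inj.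
by rewrite EFinM !lp_normE lp_enormZ.
Qed.

Let lp_norm0_eq0 (x : lp) : of_real F (lp_norm x) = 0 -> x = 0.
Proof.
rewrite -[RHS](@of_real0 R F) => /(can_inj of_realK) x0.
by apply/val_inj/lp_enorm0_eq0; rewrite -lp_normE x0.
Qed.

HB.instance Definition _ :=
  Lmodule_isNormed.Build K lp lp_normD lp_normZ lp_norm0_eq0.

Lemma lp_normrE (x : lp) : `|x| = of_real F (lp_norm x).
Proof. by []. Qed.

End SequenceSpaces.

Section Subspaces.
Context {R : realType} {F : scalar_kind}.
Local Notation K := (scalars R F).

Definition finitely_spanned (V : lmodType K) (S : {pred V}) : Prop :=
  exists (n : nat) (e : 'I_n -> V), (forall i, e i \in S) /\
    forall x, x \in S -> exists a : 'I_n -> K, x = \sum_(i < n) a i *: e i.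

(* By convention a subspace is closed and infinite dimensional. *)
Record closed_infdim_subspace (V : normedModType K) := ClosedInfdimSubspace {
  subspace_pred :> {pred V};
  subspace_submod : submod_closed subspace_pred;
  subspace_closed : closed [set x | x \in subspace_pred];
  subspace_infinite : ~ finitely_spanned subspace_pred }.

HB.instance Definition _ (V : normedModType K) (X : closed_infdim_subspace V) :=
  GRing.isSubmodClosed.Build K V (subspace_pred X)
    (subspace_submod X).

End Subspaces.

Section SubspaceType.
Context {R : realType} {F : scalar_kind}.
Local Notation K := (scalars R F).
Context {V : normedModType K} (X : closed_infdim_subspace V).

Record subspace_type : Type :=
  SubspaceElt { subspace_val :> V; subspace_valP : subspace_val \in X }.

HB.instance Definition _ := [isSub for subspace_val].
HB.instance Definition _ := [Choice of subspace_type by <:].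
HB.instance Definition _ := [SubChoice_isSubLmodule of subspace_type by <:].

Let sub_norm (x : subspace_type) : K := `|subspace_val x|.

Let sub_normD x y : sub_norm (x + y) <= sub_norm x + sub_norm y.
Proof. exact: ler_normD. Qed.

Let sub_normZ (l : K) x : sub_norm (l *: x) = `|l| * sub_norm x.
Proof. exact: normrZ. Qed.

Let sub_norm0_eq0 x : sub_norm x = 0 -> x = 0.
Proof. by move=> /normr0_eq0 x0; exact: val_inj. Qed.

HB.instance Definition _ :=
  Lmodule_isNormed.Build K subspace_type sub_normD sub_normZ sub_norm0_eq0.

Lemma subspace_normrE (x : subspace_type) : `|x| = `|subspace_val x|.
Proof. by []. Qed.

End SubspaceType.

Local Open Scope quotient_scope.

Section QuotientSpace.
Context {R : realType} {F : scalar_kind}.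
Local Notation K := (scalars R F).
Context {V : normedModType K} (X : closed_infdim_subspace V).

Definition quotient_space : Type := Quotient.quot (subspace_pred X).

HB.instance Definition _ := GRing.Zmodule.on quotient_space.
HB.instance Definition _ := EqQuotient.on quotient_space.

Definition quotient_proj (x : V) : quotient_space := \pi_(quotient_space) x.

Local Notation q := quotient_proj.

Lemma quotient_projK (u : quotient_space) : q (repr u) = u.
Proof. exact: reprK. Qed.

Lemma eq_quotient_proj x y : (q x = q y) <-> (x - y \in X).
Proof. by rewrite Quotient.idealrBE; split=> [/eqP|/eqP]. Qed.

Lemma quotient_projD x y : q (x + y) = q x + q y.
Proof. by rewrite /q raddfD. Qed.

Lemma quotient_proj0 : q 0 = 0.
Proof. by rewrite /q raddf0. Qed.

Definition quotient_scale (l : K) (u : quotient_space) : quotient_space :=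
  q (l *: repr u).

Lemma quotient_scaleE l x : quotient_scale l (q x) = q (l *: x).
Proof.
apply/eq_quotient_proj; rewrite -scalerBr rpredZ//.
by apply/eq_quotient_proj; rewrite quotient_projK.
Qed.

Let scaleA l m u :
  quotient_scale l (quotient_scale m u) = quotient_scale (l * m) u.
Proof. by rewrite -(quotient_projK u) !quotient_scaleE scalerA. Qed.

Let scale1 : left_id 1 quotient_scale.
Proof. by move=> u; rewrite -(quotient_projK u) quotient_scaleE scale1r. Qed.

Let scaleDr : right_distributive quotient_scale +%R.
Proof.
move=> l u v; rewrite -(quotient_projK u) -(quotient_projK v).
by rewrite -quotient_projD !quotient_scaleE scalerDr quotient_projD.
Qed.

Let scaleDl u : {morph quotient_scale^~ u : l m / l + m}.
Proof.
move=> l m; rewrite -(quotient_projK u) !quotient_scaleE scalerDl.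
exact: quotient_projD.
Qed.

HB.instance Definition _ := GRing.Zmodule_isLmodule.Build K quotient_space
  scaleA scale1 scaleDr scaleDl.

Lemma quotient_projZ l x : q (l *: x) = l *: q x.
Proof. by rewrite -quotient_scaleE. Qed.

Definition quotient_rnorm (u : quotient_space) : R :=
  inf [set rnorm x | x in [set x | q x = u]].

Lemma quotient_norm_le x : quotient_rnorm (q x) <= rnorm x.
Proof.
apply: ge_inf; last by exists x.
by exists 0 => _ [y _ <-]; exact: rnorm_ge0.
Qed.

Lemma le_quotient_norm (r : R) u :
  (forall x, q x = u -> r <= rnorm x) -> r <= quotient_rnorm u.
Proof.
move=> ru; apply: lb_le_inf; last by move=> _ [y yu <-]; exact: ru.
by exists (rnorm (repr u)); exists (repr u) => //; exact: quotient_projK.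
Qed.

Lemma quotient_norm_ge0 u : 0 <= quotient_rnorm u.
Proof. by apply: le_quotient_norm => x _; exact: rnorm_ge0. Qed.

Let quotient_normD (u v : quotient_space) :
  of_real F (quotient_rnorm (u + v)) <=
    of_real F (quotient_rnorm u) + of_real F (quotient_rnorm v).
Proof.
rewrite -of_realD ler_of_real -lerBlDr; apply: le_quotient_norm => x xu.
rewrite lerBlDr -lerBlDl; apply: le_quotient_norm => y yv.
rewrite lerBlDl -xu -yv -quotient_projD.
exact: le_trans (quotient_norm_le _) (ler_rnormD _ _).
Qed.

Let quotient_normZ_le (l : K) u :
  quotient_rnorm (l *: u) <= rnorm l * quotient_rnorm u.
Proof.
have [->|l0] := eqVneq l 0.
  rewrite scale0r -quotient_proj0; apply: le_trans (quotient_norm_le _) _.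
  by rewrite /rnorm !normr0 -of_real0 of_realK mul0r.
have rl0 : 0 < rnorm l.
  by rewrite lt_neqAle rnorm_ge0 andbT eq_sym; apply: contra_neq l0 => /rnorm0_eq0.
rewrite -ler_pdivrMl//; apply: le_quotient_norm => x xu.
rewrite ler_pdivrMl// -rnormZ -xu -quotient_projZ.
exact: quotient_norm_le.
Qed.

Let quotient_normZ (l : K) u :
  of_real F (quotient_rnorm (l *: u)) = `|l| * of_real F (quotient_rnorm u).
Proof.
rewrite -of_real_rnorm -of_realM; congr of_real; apply/eqP.
rewrite eq_le quotient_normZ_le/=.
have [->|l0] := eqVneq l 0.
  by rewrite {1}/rnorm !normr0 -of_real0 of_realK mul0r quotient_norm_ge0.
have rl0 : 0 < rnorm l.
  by rewrite lt_neqAle rnorm_ge0 andbT eq_sym; apply: contra_neq l0 => /rnorm0_eq0.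
have := quotient_normZ_le l^-1 (l *: u).
rewrite scalerA mulVf// scale1r => /(ler_wpM2l (ltW rl0)) /le_trans; apply.
by rewrite mulrA -rnormM mulfV// /rnorm normr1 -of_real1 of_realK mul1r.
Qed.

Let quotient_norm0_eq0 u : of_real F (quotient_rnorm u) = 0 -> u = 0.
Proof.
rewrite -[RHS](@of_real0 R F) => /(can_inj of_realK) u0.
rewrite -(quotient_projK u) -quotient_proj0; apply/eq_quotient_proj.
rewrite subr0; apply: (@subspace_closed _ _ _ X) => B.
rewrite -nbhs_ballE => -[e /= e0 eB].
have [_ [x xu <-] xe] : exists2 r, [set rnorm x | x in [set x | q x = u]] r &
    r < to_real e.
  apply: inf_lt; last first.
    by rewrite -/(quotient_rnorm u) u0 -(@ltr_of_real R F) of_real0 to_realK ?ltW.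
  by exists (rnorm (repr u)); exists (repr u) => //; exact: quotient_projK.
exists (repr u - x); split.
  by apply/eq_quotient_proj; rewrite quotient_projK.
apply: eB; rewrite -ball_normE /= opprB addrC subrK.
by rewrite -of_real_rnorm -[e]to_realK ?ltW// ltr_of_real.
Qed.

HB.instance Definition _ := Lmodule_isNormed.Build K quotient_space
  quotient_normD quotient_normZ quotient_norm0_eq0.

Lemma quotient_normrE u : `|u| = of_real F (quotient_rnorm u).
Proof. by []. Qed.

End QuotientSpace.

Definition isomorphic (K : numFieldType) (V W : normedModType K) : Prop :=
  exists (f : {linear V -> W}) (g : W -> V),
    [/\ cancel f g, cancel g f, continuous f & continuous g].

Section Subprojective.
Context {R : realType} {F : scalar_kind}.
Local Notation K := (scalars R F).

Definition complemented (V : normedModType K)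
    (Z : closed_infdim_subspace V) : Prop :=
  exists P : {linear V -> V},
    [/\ continuous P, forall x, P x \in Z & forall z, z \in Z -> P z = z].

Definition subprojective (V : completeNormedModType K) : Prop :=
  forall Y : closed_infdim_subspace V,
    exists Z : closed_infdim_subspace V, {subset Z <= Y} /\ complemented Z.

End Subprojective.

(* Main.v *)
Require Import Defs.
From HB Require Import structures.
From mathcomp Require Import all_boot all_order all_algebra.
From mathcomp Require Import complex ring lra.
From mathcomp Require Import all_classical all_reals all_analysis.

Set Implicit Arguments.
Unset Strict Implicit.
Unset Printing Implicit Defensive.

Import Order.TTheory GRing.Theory Num.Theory.
Import numFieldNormedType.Exports.

Local Open Scope classical_set_scope.
Local Open Scope ring_scope.

(** The space is the Kalton-Peck space, presented by duality so that its norm is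
    a supremum of moduli of linear forms and is therefore convex from the start.
    Let q be the exponent conjugate to p.  For a finitely supported b with
    sum |b_n|^q <= 1, [kp_form] sends a pair (x, y) of scalar sequences to

      sum_n b_n (x_n - ln|b_n| y_n),

    and Z_p consists of the pairs on which these forms are bounded, with the
    supremum of their moduli as norm.  The forms control every
    coordinate and each reads finitely many of them, so the norm is complete.

    On the subspace X_p where y = 0 the forms reduce to the duality pairing, so
    X_p is isometric to l_p.  Replacing b by b/e changes the form by the pairing
    of b with y, so the norm controls the l_p norm of y, and (x, y) |-> y induces
    an injection of Z_p/X_p into l_p.  It is onto, with bounded inverse, because a
    y in the unit ball of l_p lifts to ((p - 1) y ln|y|, y): with a = |y_n| and
    c = |b_n|, the inequality ln u <= u gives

      a c |(p - 1) ln a - ln c| <= a^p + (p - 1) c^q   ([mul_ln_le]),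

    and summation bounds the norm of the lift by p ([kp_form_lift_le]).

    No infinite dimensional W inside X_p is the range of a bounded projection P
    ([not_complemented_sub_kernel]).  A gliding hump provides, close to W,
    disjoint blocks w_1, w_2, ... of l_p norm about 1 ([hump_sequence]).  For
    every choice of signs the sequence J^(-1/p) sum_(j <= J) +- w_j lies in the
    unit ball of l_p, so its lift has norm at most p; but this lift equals

      J^(-1/p) sum_j +- (G_j - ((p - 1)/p) ln J (w_j, 0)),

    G_j being the lift of w_j.  Applying P, then pairing with the normalized sum
    of the dual blocks and choosing the signs so that the off-diagonal terms do
    not compensate the diagonal ([exists_signs]), only the diagonal matters.
    There P (w_j, 0) is nearly w_j while P G_j stays bounded, so ln J is bounded
    independently of J ([log_le_of_diagonal]), which is absurd.  Hence X_p itself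
    witnesses that Z_p is not subprojective. *)

(** * Real-valued norms over the two scalar fields *)

Section RealScalars.
Context {R : realType} {F : scalar_kind}.
Local Notation K := (scalars R F).
Local Notation ofR := (@of_real R F).
Implicit Types (a : R) (x : K).

Lemma to_realD x y : to_real (x + y) = to_real x + to_real y.
Proof. by case: F x y => //= -[a b] [c d]. Qed.

Lemma to_realN x : to_real (- x) = - to_real x.
Proof. by case: F x => //= -[a b]. Qed.

Lemma to_realZ a x : to_real (ofR a * x) = a * to_real x.
Proof. by case: F x => //= -[b c] /=; rewrite mul0r subr0. Qed.

Lemma to_real_le_rnorm x : `|to_real x| <= rnorm x.
Proof.
rewrite -(@ler_of_real R F) of_real_rnorm.
by case: F x => //= x; exact: normc_ge_Re.
Qed.

Lemma of_realN a : ofR (- a) = - ofR a.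
Proof. by case: F => //=; rewrite rmorphN. Qed.

Lemma of_realB a b : ofR (a - b) = ofR a - ofR b.
Proof. by rewrite of_realD of_realN. Qed.

Lemma of_real_sum n (f : nat -> R) :
  ofR (\sum_(i < n) f i) = \sum_(i < n) ofR (f i).
Proof.
elim: n => [|n IH]; first by rewrite !big_ord0 of_real0.
by rewrite !big_ord_recr/= of_realD IH.
Qed.

Lemma to_real_sum n (f : nat -> K) :
  to_real (\sum_(i < n) f i) = \sum_(i < n) to_real (f i).
Proof.
elim: n => [|n IH]; first by rewrite !big_ord0 -(of_real0 (F := F)) of_realK.
by rewrite !big_ord_recr/= to_realD IH.
Qed.

Lemma rnorm_of_real a : rnorm (ofR a) = `|a|.
Proof.
apply: (can_inj (@of_realK R F)); rewrite of_real_rnorm.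
by case: F => //=; rewrite normc_def/= expr0n addr0 sqrtr_sqr.
Qed.

Section Rnorm.
Context {V : normedModType K}.
Implicit Types v : V.

Lemma rnorm0 : rnorm (0 : V) = 0.
Proof. by rewrite /rnorm normr0 -of_real0 of_realK. Qed.

Lemma rnormN v : rnorm (- v) = rnorm v.
Proof. by rewrite /rnorm normrN. Qed.

Lemma rnorm_distC v w : rnorm (v - w) = rnorm (w - v).
Proof. by rewrite -rnormN opprB. Qed.

Lemma rnorm_sum n (f : nat -> V) :
  rnorm (\sum_(i < n) f i) <= \sum_(i < n) rnorm (f i).
Proof.
elim: n => [|n IH]; first by rewrite !big_ord0 rnorm0.
by rewrite !big_ord_recr/= (le_trans (ler_rnormD _ _))// lerD2r.
Qed.

Lemma rnorm_gt0 v : (0 < rnorm v) = (v != 0).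
Proof.
rewrite lt_neqAle rnorm_ge0 andbT eq_sym; congr (~~ _).
by apply/eqP/eqP => [/rnorm0_eq0//|->]; rewrite rnorm0.
Qed.

End Rnorm.

Lemma rnormZr (V : normedModType K) a (v : V) : rnorm (ofR a *: v) = `|a| * rnorm v.
Proof. by rewrite rnormZ rnorm_of_real. Qed.

(** The number |x|/x is the phase that turns x into its modulus. *)
Lemma rnorm_div_self x : x != 0 -> rnorm (ofR (rnorm x) / x) = 1.
Proof.
move=> x0; have x0' : rnorm x != 0.
  by apply: contra_neq x0 => /rnorm0_eq0.
apply: (mulIf x0'); rewrite -rnormM divfK// rnorm_of_real mul1r.
by rewrite ger0_norm ?rnorm_ge0.
Qed.

Lemma ball_rnorm (V : normedModType K) (v w : V) e :
  ball v (ofR e) w <-> rnorm (v - w) < e.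
Proof. by rewrite -ball_normE /= -of_real_rnorm ltr_of_real. Qed.

Lemma gt0_of_realP (e : K) : 0 < e -> exists2 a, e = ofR a & 0 < a.
Proof.
move=> e0; have ea : ofR (to_real e) = e by rewrite to_realK ?ltW.
by exists (to_real e); rewrite -?(@ltr_of_real R F) ea ?of_real0.
Qed.

Lemma of_real_gt0 a : (0 < ofR a) = (0 < a).
Proof. by rewrite -(@of_real0 R F) ltr_of_real. Qed.

(** Filters on a normed module are described here with real radii, because
    the radii of balls are scalars, which in the complex case are only partially
    ordered. *)
Lemma cvg_rnormP (V : normedModType K) (G : set_system V) (l : V) : Filter G ->
  (G --> l) <-> forall e, 0 < e -> G [set v | rnorm (l - v) < e].
Proof.
move=> GF; split=> [/cvg_ballP Gl e e0|Gl].
  have := Gl (ofR e); rewrite of_real_gt0 => /(_ e0).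
  by apply: filterS => v /ball_rnorm.
apply/cvg_ballP => _ /gt0_of_realP[e -> /Gl].
by apply: filterS => v /ball_rnorm.
Qed.

Lemma cauchy_rnorm (V : normedModType K) (G : set_system V) : ProperFilter G ->
  cauchy G -> forall e, 0 < e -> exists v, G [set w | rnorm (v - w) < e].
Proof.
move=> GF /cauchyP Gc e e0.
have := Gc (ofR e); rewrite of_real_gt0 => /(_ e0)[v Gv].
by exists v; apply: filterS Gv => w /ball_rnorm.
Qed.

Lemma lipschitz_rnorm_cauchy (V W : normedModType K) (f : V -> W) C
    (G : set_system V) : ProperFilter G ->
  (forall v w, rnorm (f v - f w) <= C * rnorm (v - w)) ->
  cauchy G -> cauchy (f @ G).
Proof.
move=> GF fC Gc; apply/cauchyP => _ /gt0_of_realP[e -> e0].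
pose D := `|C| + 1; have D0 : 0 < D by rewrite ltr_wpDl.
have [|v Gv] := cauchy_rnorm GF Gc (e := D^-1 * e); first by rewrite mulr_gt0// invr_gt0.
exists (f v); suff: G [set w | ball (f v) (ofR e) (f w)] by [].
apply: filterS Gv => w /= vw; apply/ball_rnorm.
rewrite (le_lt_trans (fC _ _))// (@le_lt_trans _ _ (D * rnorm (v - w)))//.
  by rewrite ler_wpM2r ?rnorm_ge0// (le_trans (ler_norm _))// lerDl.
by rewrite -ltr_pdivlMl.
Qed.

Lemma lipschitz_rnorm_continuous (V W : normedModType K) (f : V -> W) C :
  (forall v w, rnorm (f v - f w) <= C * rnorm (v - w)) -> continuous f.
Proof.
move=> fC v; apply/cvg_rnormP => e e0.
pose D := `|C| + 1; have D0 : 0 < D by rewrite ltr_wpDl.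
have /cvg_rnormP : nbhs v --> v by [].
move=> /(_ (D^-1 * e)); rewrite mulr_gt0// ?invr_gt0// => /(_ isT) Nv.
suff: nbhs v [set w | rnorm (f v - f w) < e] by [].
apply: filterS Nv => w /= vw.
rewrite (le_lt_trans (fC _ _))// (@le_lt_trans _ _ (D * rnorm (v - w)))//.
  by rewrite ler_wpM2r ?rnorm_ge0// (le_trans (ler_norm _))// lerDl.
by rewrite -ltr_pdivlMl.
Qed.

Lemma continuous_rnorm_bounded (V W : normedModType K) (f : {linear V -> W}) :
  continuous f -> exists2 C, 0 <= C & forall v, rnorm (f v) <= C * rnorm v.
Proof.
move=> /(_ 0)/continuous_linear_bounded/linear_boundedP/pinfty_ex_gt0 [M M0 fM].
exists (to_real M); first by rewrite -(@ler_of_real R F) to_realK ?of_real0 ltW.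
move=> v; rewrite -(@ler_of_real R F) of_realM !of_real_rnorm to_realK; last exact: ltW.
exact: fM.
Qed.

End RealScalars.

Lemma sqrt_sqrD_le (R : realType) (x y : R) :
  Num.sqrt (x ^+ 2 + y ^+ 2) <= `|x| + `|y|.
Proof.
rewrite -[leRHS]ger0_norm ?addr_ge0// -sqrtr_sqr ler_wsqrtr//.
by rewrite sqrrD !real_normK ?num_real// addrAC lerDl mulrn_wge0// mulr_ge0.
Qed.

Section ScalarsComplete.
Context {R : realType} {F : scalar_kind}.
Local Notation K := (scalars R F).

(** Over the complex scalars the real and imaginary parts are 1-Lipschitz, so
    completeness of the real line applies to each of them. *)
Lemma scalars_cauchy_cvg (G : set_system K) : ProperFilter G -> cauchy G ->
  exists l : K, G --> l.
Proof.
move=> GF Gc.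
have real_lim (h : K -> R) : (forall x y, `|h x - h y| <= rnorm (x - y)) ->
    exists l : R, forall e, 0 < e -> G [set x | `|l - h x| < e].
  move=> h1; have : cvg (h @ G).
    apply: cauchy_cvg; apply: cauchy_exP => e e0; have [x Gx] := cauchy_rnorm GF Gc e0.
    exists (h x); suff: G [set y | `|h x - h y| < e] by [].
    by apply: filterS Gx => y; exact: le_lt_trans.
  move=> /cvg_ex[l /cvgrPdist_lt hl]; exists l => e e0.
  exact: hl.
have [a Ga] : exists l, forall e, 0 < e -> G [set x | `|l - to_real x| < e].
  apply: real_lim => x y; rewrite -to_realN -to_realD; exact: to_real_le_rnorm.
case: F G GF Gc real_lim a Ga => [|] G GF Gc real_lim a Ga.
  by exists a; apply/cvg_rnormP => e /Ga.
have [b Gb] : exists l, forall e, 0 < e -> G [set x : R[i] | `|l - complex.Im x| < e].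
  apply: real_lim => x y; rewrite -(@ler_of_real R ComplexScalars) of_real_rnorm.
  have -> : complex.Im x - complex.Im y = complex.Im (x - y) by case: x y => [? ?] [].
  rewrite /= normc_def lecR.
  by rewrite -sqrtr_sqr ler_wsqrtr// lerDr sqr_ge0.
exists (a +i* b)%C; apply/cvg_rnormP => e e0.
have e2 : 0 < e / 2 by rewrite divr_gt0.
apply: filterS2 (Ga _ e2) (Gb _ e2) => -[c d] /= ac bd.
rewrite /rnorm /= (splitr e) (le_lt_trans _ (ltrD ac bd))//.
exact: sqrt_sqrD_le.
Qed.
End ScalarsComplete.

(** * Conjugate exponents and finite sums *)

Definition conjexp (R : realType) (p : R) : R := p / (p - 1).

Section RealInequalities.
Context {R : realType} {p : R}.
Hypothesis p1 : 1 < p.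
Local Notation q := (conjexp p).

Let p0 : 0 < p. Proof. exact: lt_trans p1. Qed.
Let pm0 : 0 < p - 1. Proof. by rewrite subr_gt0. Qed.

Lemma conjexp_gt0 : 0 < q.
Proof. by rewrite divr_gt0. Qed.

Lemma conjexp_inv : p^-1 + q^-1 = 1.
Proof. by rewrite /conjexp; field; rewrite !gt_eqF. Qed.

Lemma conjexp_mul : (p - 1) * q = p.
Proof. by rewrite /conjexp; field; rewrite gt_eqF. Qed.

(** This is ln u <= u at u = a^(r-1)/c, multiplied by a c. *)
Lemma mulB_ln_le (r a c : R) : 0 < r -> 0 < a -> 0 < c ->
  a * c * ((r - 1) * ln a - ln c) <= a `^ r.
Proof.
move=> r0 a0 c0; rewrite -(mulr_powRB1 (ltW a0) r0) -mulrA ler_wpM2l ?ltW//.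
have t0 : 0 < a `^ (r - 1) / c by rewrite divr_gt0 ?powR_gt0.
rewrite -ln_powR -ln_div ?posrE ?powR_gt0//.
by rewrite (mulrC c) -ltr_pdivlMr ?ln_sublinear.
Qed.

(** With s = a^p and t = c^q the left-hand side is s^(1/p) t^(1/q) |ln (s/t)|/q:
    the geometric mean absorbs the logarithm whichever of the two is larger.  This is the inequality that makes the lift
    y |-> (p - 1) y ln|y| bounded. *)
Lemma mul_ln_le (a c : R) : 0 <= a -> 0 <= c ->
  a * c * `|(p - 1) * ln a - ln c| <= a `^ p + (p - 1) * c `^ q.
Proof.
move=> a0 c0.
have rhs0 : 0 <= a `^ p + (p - 1) * c `^ q.
  by rewrite addr_ge0 ?powR_ge0// mulr_ge0 ?powR_ge0// ltW.
have [->|an0] := eqVneq a 0; first by rewrite !mul0r powR0 ?gt_eqF// add0r mulr_ge0 ?powR_ge0 ?ltW.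
have [->|cn0] := eqVneq c 0; first by rewrite mulr0 mul0r addr_ge0 ?powR_ge0// mulr_ge0 ?powR_ge0// ltW.
have {an0}a0 : 0 < a by rewrite lt_neqAle eq_sym an0.
have {cn0}c0 : 0 < c by rewrite lt_neqAle eq_sym cn0.
have ac0 : 0 <= a * c by rewrite mulr_ge0// ltW.
rewrite -[X in X * `|_|]ger0_norm// -normrM ler_norml; apply/andP; split.
  rewrite lerNl -mulrN opprB.
  have -> : ln c - (p - 1) * ln a = (p - 1) * ((q - 1) * ln c - ln a).
    by rewrite /conjexp; field; rewrite gt_eqF.
  rewrite mulrCA (mulrC a) (le_trans (ler_wpM2l (ltW pm0) (mulB_ln_le conjexp_gt0 c0 a0)))//.
  by rewrite lerDr powR_ge0.
rewrite (le_trans (mulB_ln_le p0 a0 c0))// lerDl mulr_ge0 ?powR_ge0//.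
exact: ltW.
Qed.

End RealInequalities.

Section FiniteSums.
Context {R : realType} {F : scalar_kind}.
Local Notation K := (scalars R F).
Local Notation ofR := (@of_real R F).
Implicit Types (x y b : nat -> K) (r : R) (m : nat).

Definition powsum r m x : R := \sum_(n < m) rnorm (x n) `^ r.
Definition pairing m b x : K := \sum_(n < m) b n * x n.

(** The sequence at which Hoelder's inequality for x is an equality. *)
Definition dual (p : R) x : nat -> K :=
  fun n => ofR (rnorm (x n) `^ (p - 1)) * (ofR (rnorm (x n)) / x n).

Lemma powsum_ge0 r m x : 0 <= powsum r m x.
Proof. by apply: sumr_ge0 => i _; exact: powR_ge0. Qed.

Lemma powsumS r m x : powsum r m.+1 x = powsum r m x + rnorm (x m) `^ r.
Proof. by rewrite /powsum big_ord_recr. Qed.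

Lemma le_powsum r x m k : (m <= k)%N -> powsum r m x <= powsum r k x.
Proof.
move=> /subnK <-; elim: (k - m)%N => [//|j IH].
by rewrite addSn powsumS (le_trans IH)// lerDl powR_ge0.
Qed.

Lemma powsumZ r m (l : K) x : powsum r m (l *: x) = rnorm l `^ r * powsum r m x.
Proof.
rewrite /powsum mulr_sumr; apply: eq_bigr => i _.
by rewrite (rnormM l) powRM ?rnorm_ge0.
Qed.

Lemma pairingZl m (l : K) b x : pairing m (l *: b) x = l * pairing m b x.
Proof. by rewrite /pairing mulr_sumr; apply: eq_bigr => i _; rewrite mulrA. Qed.

Lemma pairingZr m (l : K) b x : pairing m b (l *: x) = l * pairing m b x.
Proof. by rewrite /pairing mulr_sumr; apply: eq_bigr => i _; rewrite mulrCA. Qed.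

Lemma pairing_scalar m (b : nat -> K) : scalar (pairing m b).
Proof.
move=> l x y; rewrite /pairing mulr_sumr -big_split; apply: eq_bigr => n _ /=.
by rewrite -[(l *: x + y) n]/(l * x n + y n); ring.
Qed.

Context {p : R}.
Hypothesis p1 : 1 < p.
Local Notation q := (conjexp p).

Let p0 : 0 < p. Proof. exact: lt_trans p1. Qed.
Let q0 : 0 < q. Proof. exact: conjexp_gt0. Qed.

Lemma pairing_le1 m b x : powsum q m b <= 1 -> powsum p m x <= 1 ->
  rnorm (pairing m b x) <= 1.
Proof.
move=> b1 x1; apply: le_trans (rnorm_sum _ (fun n => b n * x n)) _.
apply: (@le_trans _ _ (powsum p m x / p + powsum q m b / q)); last first.
  by rewrite -(conjexp_inv p1) lerD// ler_piMl// invr_ge0 ltW.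
rewrite /powsum !mulr_suml -big_split/=; apply: ler_sum => i _.
by rewrite rnormM mulrC conjugate_powR ?rnorm_ge0// conjexp_inv.
Qed.

Lemma pairing_le m b x r : 0 < r -> powsum q m b <= 1 -> powsum p m x <= r `^ p ->
  rnorm (pairing m b x) <= r.
Proof.
move=> r0 b1 xr.
have := @pairing_le1 m b (ofR r^-1 *: x) b1.
rewrite powsumZ pairingZr rnormM !rnorm_of_real gtr0_norm ?invr_gt0//.
have -> : r^-1 `^ p = (r `^ p)^-1.
  by rewrite -powR_inv1 ?ltW// -powRrM mulN1r powRN.
by rewrite !ler_pdivrMl ?powR_gt0// !mulr1; apply.
Qed.

Lemma dual_eq0 x n : x n = 0 -> dual p x n = 0.
Proof. by move=> xn; rewrite /dual xn invr0 !mulr0. Qed.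

Lemma powsum_dual m x : powsum q m (dual p x) = powsum p m x.
Proof.
apply: eq_bigr => i _.
have [xi|xi] := eqVneq (x i) 0.
  by rewrite dual_eq0// xi rnorm0 !powR0 ?gt_eqF.
by rewrite rnormM rnorm_div_self// mulr1 rnorm_of_real ger0_norm ?powR_ge0// -powRrM conjexp_mul.
Qed.

Lemma pairing_dual m x : pairing m (dual p x) x = ofR (powsum p m x).
Proof.
rewrite [in RHS]/powsum (of_real_sum m (fun n => rnorm (x n) `^ p)); apply: eq_bigr => i _.
have [xi|xi] := eqVneq (x i) 0.
  by rewrite xi rnorm0 mulr0 powR0 ?gt_eqF// of_real0.
by rewrite -mulrA divfK// -of_realM mulrC mulr_powRB1 ?rnorm_ge0.
Qed.

(** The supremum over b is attained at the normalized dual sequence of x. *)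
Lemma powsum_duality m x r : 0 <= r ->
  (forall b, powsum q m b <= 1 -> rnorm (pairing m b x) <= r) ->
  powsum p m x <= r `^ p.
Proof.
move=> r0 h; set S := powsum p m x.
have : 0 <= S by exact: powsum_ge0.
rewrite le_eqVlt => /predU1P[<-|S0]; first exact: powR_ge0.
have := h (ofR (S `^ (- q^-1)) *: dual p x).
rewrite powsumZ pairingZl powsum_dual pairing_dual rnormM !rnorm_of_real.
rewrite -/S ger0_norm ?powR_ge0// -powRrM mulNr mulVf ?gt_eqF// (powR_inv1 (ltW S0)).
rewrite mulVf ?gt_eqF// => /(_ (lexx _)).
rewrite gtr0_norm// -{2}(powRr1 (ltW S0)) -powRD ?(gt_eqF S0) ?implybT//.
rewrite addrC -(conjexp_inv p1) addrK => /(ge0_ler_powR (ltW p0)).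
by rewrite -powRrM mulVf ?gt_eqF// (powRr1 (ltW S0)); apply; rewrite nnegrE ?powR_ge0.
Qed.

End FiniteSums.

(** * The Kalton-Peck forms *)

Section KaltonPeckForm.
Context {R : realType} {F : scalar_kind}.
Local Notation K := (scalars R F).
Local Notation ofR := (@of_real R F).
Local Notation V := ((nat -> K) * (nat -> K))%type.
Implicit Types (x y b : nat -> K) (m : nat) (z : V).

Definition kp_form m b z : K :=
  \sum_(n < m) b n * (z.1 n - ofR (ln (rnorm (b n))) * z.2 n).

Lemma kp_formD m b z w : kp_form m b (z + w) = kp_form m b z + kp_form m b w.
Proof.
rewrite /kp_form -big_split; apply: eq_bigr => i _.
rewrite -[(z + w).1 i]/(z.1 i + w.1 i) -[(z + w).2 i]/(z.2 i + w.2 i) /=; ring.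
Qed.

Lemma kp_formZ m b (l : K) z : kp_form m b (l *: z) = l * kp_form m b z.
Proof.
rewrite /kp_form mulr_sumr; apply: eq_bigr => i _.
rewrite -[(l *: z).1 i]/(l * z.1 i) -[(l *: z).2 i]/(l * z.2 i); ring.
Qed.

Lemma kp_formB m b z w : kp_form m b (z - w) = kp_form m b z - kp_form m b w.
Proof. by rewrite -scaleN1r kp_formD kp_formZ mulN1r. Qed.

Lemma kp_form_fst m b z : z.2 = 0 -> kp_form m b z = pairing m b z.1.
Proof. by move=> z2; apply: eq_bigr => i _; rewrite z2 mulr0 subr0. Qed.

(** Dividing b by e shifts ln|b_n| by -1, which exposes the pairing of b with the
    second component; this is how the forms control that component. *)
Lemma kp_form_expR m b z :
  kp_form m (ofR (expR (-1)) *: b) z =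
  ofR (expR (-1)) * (kp_form m b z + pairing m b z.2).
Proof.
rewrite /kp_form /pairing -big_split mulr_sumr; apply: eq_bigr => i _ /=.
rewrite -[(_ *: b) i]/(ofR (expR (-1)) * b i).
have [->|bi] := eqVneq (b i) 0; first by rewrite mulr0 !mul0r addr0 mulr0.
rewrite rnormM rnorm_of_real ger0_norm ?expR_ge0// lnM ?posrE ?expR_gt0 ?rnorm_gt0//.
by rewrite expRK of_realD of_realN of_real1; ring.
Qed.

Definition delta_seq m : nat -> K := fun n => (n == m)%:R.

Lemma delta_sum m (f : nat -> K) : \sum_(n < m.+1) delta_seq m n * f n = f m.
Proof.
rewrite big_ord_recr/= /delta_seq eqxx mul1r big1 ?add0r// => i _.
by rewrite (ltn_eqF (ltn_ord i)) mul0r.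
Qed.

Lemma powsum_delta r m : r != 0 -> powsum r m.+1 (delta_seq m) = 1.
Proof.
move=> r0; rewrite powsumS /powsum big1 ?add0r => [|i _]; rewrite /delta_seq.
  by rewrite eqxx -of_real1 rnorm_of_real normr1 powR1.
by rewrite (ltn_eqF (ltn_ord i)) rnorm0 powR0.
Qed.

Lemma pairing_delta m x : pairing m.+1 (delta_seq m) x = x m.
Proof. exact: delta_sum. Qed.

Lemma kp_form_delta m z : kp_form m.+1 (delta_seq m) z = z.1 m.
Proof.
rewrite /kp_form
  (delta_sum m (fun n => z.1 n - ofR (ln (rnorm (delta_seq m n))) * z.2 n)).
rewrite /delta_seq eqxx -of_real1 rnorm_of_real normr1 ln1.
by rewrite of_real0 mul0r subr0.
Qed.

Section Estimates.
Context {p : R}.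
Hypothesis p1 : 1 < p.
Local Notation q := (conjexp p).

(** The first component is the Kalton-Peck map.  With the factor p - 1 it cancels
    ln|b_n| y_n exactly when b is the dual sequence of y, for which
    |b_n| = |y_n|^(p-1). *)
Definition kp_lift (p : R) y : V :=
  (fun n => ofR ((p - 1) * ln (rnorm (y n))) * y n, y).

Lemma kp_form_lift_le m b y : powsum q m b <= 1 -> powsum p m y <= 1 ->
  rnorm (kp_form m b (kp_lift p y)) <= p.
Proof.
move=> b1 y1.
apply: le_trans (rnorm_sum _
  (fun n => b n * ((kp_lift p y).1 n - ofR (ln (rnorm (b n))) * y n))) _ => /=.
apply: (@le_trans _ _ (powsum p m y + (p - 1) * powsum q m b)); last first.
  rewrite -[leRHS](subrKC 1) lerD// ler_piMr// subr_ge0; exact: ltW.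
rewrite /powsum mulr_sumr -big_split/=; apply: ler_sum => i _.
rewrite -mulrBl -of_realB !rnormM rnorm_of_real.
rewrite mulrA mulrAC (mulrC (rnorm (b i))).
by apply: mul_ln_le; rewrite ?rnorm_ge0.
Qed.

Lemma kp_pairing_le m b z M :
  (forall c, powsum q m c <= 1 -> rnorm (kp_form m c z) <= M) ->
  powsum q m b <= 1 -> rnorm (pairing m b z.2) <= (expR 1 + 1) * M.
Proof.
move=> zM b1.
have e0 : 0 <= expR (-1) :> R by exact: expR_ge0.
have := zM (ofR (expR (-1)) *: b).
rewrite kp_form_expR powsumZ rnormM rnorm_of_real ger0_norm// => h.
have {}h : rnorm (kp_form m b z + pairing m b z.2) <= expR 1 * M.
  rewrite -ler_pdivrMl ?expR_gt0// -expRN; apply: h.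
  rewrite mulr_ile1 ?powR_ge0 ?powsum_ge0//.
  apply: (@le_trans _ _ (1 `^ q)); last by rewrite powR1.
  rewrite ge0_ler_powR ?nnegrE ?ler01//; first exact/ltW/conjexp_gt0.
rewrite -[pairing _ _ _](addKr (kp_form m b z)) (le_trans (ler_rnormD _ _))//.
by rewrite rnormN mulrDl mul1r addrC lerD// zM.
Qed.

End Estimates.
End KaltonPeckForm.

(** * The Kalton-Peck space *)

Section KaltonPeckSpace.
Context {R : realType} (F : scalar_kind).
Local Notation K := (scalars R F).
Local Notation ofR := (@of_real R F).
Local Notation V := ((nat -> K) * (nat -> K))%type.

Definition kp_bounded (p : R) (z : V) M :=
  forall m b, powsum (conjexp p) m b <= 1 -> rnorm (kp_form m b z) <= M.

(** Carrying the proof of 1 < p lets instance inference find the normed structure,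
    in which a nonzero pair has positive norm because 1 < p. *)
Definition kp_pred (p : R) (_ : 1 < p) : {pred V} :=
  [pred z | `[< exists M, kp_bounded p z M >]].

Variables (p : R) (p1 : 1 < p).
Local Notation q := (conjexp p).

Lemma kp_submod_closed : submod_closed (kp_pred p1).
Proof.
split.
  apply/asboolP; exists 0 => m b b1.
  by rewrite -(scale0r (0 : V)) kp_formZ mul0r rnorm0.
move=> l z w /asboolP[M zM] /asboolP[N wN]; apply/asboolP.
exists (rnorm l * M + N) => m b b1.
rewrite kp_formD kp_formZ (le_trans (ler_rnormD _ _))// rnormM lerD ?wN//.
by rewrite ler_wpM2l ?rnorm_ge0// zM.
Qed.

HB.instance Definition _ :=
  GRing.isSubmodClosed.Build K V (kp_pred p1) kp_submod_closed.

Record kalton_peck : Type := KaltonPeck {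
  kp_val :> V; kp_valP : kp_val \in kp_pred p1 }.

HB.instance Definition _ := [isSub for kp_val].
HB.instance Definition _ := [Choice of kalton_peck by <:].
HB.instance Definition _ := [SubChoice_isSubLmodule of kalton_peck by <:].

Lemma kp_ext (z w : kalton_peck) : z.1 = w.1 -> z.2 = w.2 -> z = w.
Proof.
move=> zw1 zw2; apply: val_inj => /=.
by rewrite (surjective_pairing (kp_val z)) zw1 zw2 -surjective_pairing.
Qed.

Definition kp_norm (z : kalton_peck) : R :=
  sup [set r | exists m b, powsum q m b <= 1 /\ r = rnorm (kp_form m b z)].

Lemma kp_norm_le (z : kalton_peck) M : kp_bounded p z M -> kp_norm z <= M.
Proof.
move=> zM; apply: ge_sup => [|_ [m [b [b1 ->]]]]; last exact: zM.
exists (rnorm (kp_form 0 0 z)), 0%N, 0; split=> //.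
by rewrite /powsum big_ord0.
Qed.

Lemma kp_bounded_norm (z : kalton_peck) : kp_bounded p z (kp_norm z).
Proof.
move=> m b b1; apply: ub_le_sup; last by exists m, b.
by have /asboolP[M zM] := kp_valP z; exists M => _ [n [c [c1 ->]]]; exact: zM.
Qed.

Let kp_normD (z w : kalton_peck) :
  ofR (kp_norm (z + w)) <= ofR (kp_norm z) + ofR (kp_norm w).
Proof.
rewrite -of_realD ler_of_real; apply: kp_norm_le => m b b1.
by rewrite kp_formD (le_trans (ler_rnormD _ _))// lerD// kp_bounded_norm.
Qed.

Let kp_normZ_le (l : K) z : kp_norm (l *: z) <= rnorm l * kp_norm z.
Proof.
apply: kp_norm_le => m b b1.
by rewrite kp_formZ rnormM ler_wpM2l ?rnorm_ge0// kp_bounded_norm.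
Qed.

Let kp_normZ (l : K) z : ofR (kp_norm (l *: z)) = `|l| * ofR (kp_norm z).
Proof.
rewrite -of_real_rnorm -of_realM; congr of_real.
apply/eqP; rewrite eq_le kp_normZ_le/=.
have [->|l0] := eqVneq l 0.
  rewrite rnorm0 mul0r (le_trans _ (@kp_bounded_norm _ 0 0 _)) ?rnorm_ge0//.
  by rewrite /powsum big_ord0.
have rl0 : 0 < rnorm l by rewrite rnorm_gt0.
have := kp_normZ_le l^-1 (l *: z).
rewrite scalerA mulVf// scale1r => /(ler_wpM2l (ltW rl0)) /le_trans; apply.
by rewrite mulrA -rnormM mulfV// -of_real1 rnorm_of_real normr1 mul1r.
Qed.

Lemma kp_bounded_fst z M n : kp_bounded p z M -> rnorm (z.1 n) <= M.
Proof.
move=> zM; rewrite -kp_form_delta zM// powsum_delta//.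
by rewrite gt_eqF// conjexp_gt0.
Qed.

Lemma kp_bounded_snd z M n : kp_bounded p z M -> rnorm (z.2 n) <= (expR 1 + 1) * M.
Proof.
move=> zM; rewrite -(pairing_delta n z.2) (kp_pairing_le p1 (M := M) (z := z))//.
  by move=> c; exact: zM.
by rewrite powsum_delta// gt_eqF// conjexp_gt0.
Qed.

Let kp_norm0_eq0 z : ofR (kp_norm z) = 0 -> z = 0.
Proof.
rewrite -[RHS](@of_real0 R F) => /(can_inj of_realK) z0.
have zb := kp_bounded_norm z; rewrite z0 in zb.
apply: kp_ext; apply/funext => n; apply: rnorm0_eq0; apply/eqP.
  by rewrite eq_le rnorm_ge0 (kp_bounded_fst _ zb).
by rewrite eq_le rnorm_ge0 -[leRHS](mulr0 (expR 1 + 1)) (kp_bounded_snd _ zb).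
Qed.

HB.instance Definition _ :=
  Lmodule_isNormed.Build K kalton_peck kp_normD kp_normZ kp_norm0_eq0.

Lemma kp_rnormE (z : kalton_peck) : rnorm z = kp_norm z.
Proof. exact: of_realK. Qed.

End KaltonPeckSpace.

Section KaltonPeckComplete.
Context {R : realType} {F : scalar_kind} {p : R} (p1 : 1 < p).
Local Notation K := (scalars R F).
Local Notation ofR := (@of_real R F).
Local Notation Z := (kalton_peck F p1).
Implicit Types z w : Z.

Lemma kp_form_le z m b : powsum (conjexp p) m b <= 1 ->
  rnorm (kp_form m b z) <= rnorm z.
Proof. by move=> b1; rewrite kp_rnormE kp_bounded_norm. Qed.

Lemma kp_rnorm_le z M : kp_bounded p z M -> rnorm z <= M.
Proof. by rewrite kp_rnormE; exact: kp_norm_le. Qed.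

Lemma kp_rnorm_bounded z : kp_bounded p z (rnorm z).
Proof. by move=> m b; exact: kp_form_le. Qed.

Lemma kp_fst_lipschitz n z w : rnorm (z.1 n - w.1 n) <= 1 * rnorm (z - w).
Proof. by rewrite mul1r; exact: (kp_bounded_fst p1 n (kp_rnorm_bounded (z - w))). Qed.

Lemma kp_snd_lipschitz n z w :
  rnorm (z.2 n - w.2 n) <= (expR 1 + 1) * rnorm (z - w).
Proof. exact: (kp_bounded_snd p1 n (kp_rnorm_bounded (z - w))). Qed.

(** Both coordinates are Lipschitz, so a Cauchy filter has coordinatewise limits;
    each form depends on finitely many coordinates, hence passes to the limit,
    and a bound valid for all forms is a bound on the norm. *)
Lemma kp_complete (G : set_system Z) : ProperFilter G -> cauchy G -> cvg G.
Proof.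
move=> GF Gc.
have lim1 n : {l : K | (fun z : Z => z.1 n) @ G --> l}.
  apply: cid; apply: scalars_cauchy_cvg.
  exact: lipschitz_rnorm_cauchy (kp_fst_lipschitz n) Gc.
have lim2 n : {l : K | (fun z : Z => z.2 n) @ G --> l}.
  apply: cid; apply: scalars_cauchy_cvg.
  exact: lipschitz_rnorm_cauchy (kp_snd_lipschitz n) Gc.
pose v := (fun n => sval (lim1 n), fun n => sval (lim2 n)).
have form_cvg m b : (fun z : Z => kp_form m b z) @ G --> kp_form m b v.
  rewrite /kp_form; apply: cvg_big => [|i _]; first exact: add_continuous.
  apply: cvgM; first exact: cvg_cst.
  apply: cvgB; first exact: (svalP (lim1 i)).
  by apply: cvgM; [exact: cvg_cst|exact: (svalP (lim2 i))].
have form_le e : 0 < e -> exists w, G [set z : Z | rnorm (w - z) < e] /\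
    kp_bounded p (kp_val w - v) e.
  move=> e0; have [w Gw] := cauchy_rnorm GF Gc e0; exists w; split=> // m b b1.
  apply/ler_addgt0Pr => d d0.
  have /cvg_rnormP/(_ _ d0) Gd := form_cvg m b.
  have [z [/= wz zd]] := @filter_ex _ G _ _ (@filterI _ G _ _ _ Gw Gd).
  rewrite -[X in kp_form m b X](subrKA (kp_val z)) kp_formD.
  rewrite (le_trans (ler_rnormD _ _))// lerD//.
    by rewrite (le_trans _ (ltW wz))// -[kp_val w - kp_val z]/(kp_val (w - z)) kp_form_le.
  by rewrite kp_formB rnorm_distC ltW.
have vP : v \in kp_pred p1.
  have [w [_ wv]] := form_le 1 ltr01.
  rewrite -[v](subKr (kp_val w)) rpredB ?kp_valP//.
  by apply/asboolP; exists 1.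
pose vZ : Z := KaltonPeck vP.
apply/cvg_ex; exists vZ; apply/cvg_rnormP => e e0.
have e2 : 0 < e / 2 by rewrite divr_gt0.
have [w [Gw wv]] := form_le _ e2; apply: filterS Gw => z /= wz.
rewrite -(subrKA w) (splitr e) (le_lt_trans (ler_rnormD _ _))// ler_ltD//.
by rewrite rnorm_distC kp_rnorm_le.
Qed.

HB.instance Definition _ := Uniform_isComplete.Build Z kp_complete.

End KaltonPeckComplete.

(** * Finite dimensionality through linear functionals *)

Section FiniteDimension.
Context {R : realType} {F : scalar_kind}.
Local Notation K := (scalars R F).
Context {V : normedModType K}.
Implicit Types (S : {pred V}) (L : nat -> V -> K) (m : nat).

Lemma scalar_sum (f : V -> K) n (a : 'I_n -> K) (v : 'I_n -> V) : scalar f ->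
  f (\sum_i a i *: v i) = \sum_i a i * f (v i).
Proof.
move=> fl; elim: n a v => [|n IH] a v.
  rewrite !big_ord0; have := fl (-1) 0 0.
  by rewrite scaler0 addr0 mulN1r addNr.
by rewrite !big_ord_recl/= fl IH.
Qed.

(** A biorthogonal sequence would otherwise factor an identity matrix of size
    n + 1 through dimension n. *)
Lemma not_finitely_spanned S (e : nat -> V) L : (forall i, scalar (L i)) ->
  (forall i, e i \in S) -> (forall i j, L i (e j) = (j == i)%:R) ->
  ~ finitely_spanned S.
Proof.
move=> Ll eS Le [n [v [_ vS]]].
have [a ea] : exists a : nat -> 'I_n -> K, forall k, e k = \sum_i a k i *: v i.
  by have [a ea] := choice (fun k => vS _ (eS k)); exists a.
pose A : 'M[K]_(n.+1, n) := \matrix_(k, i) a k i.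
pose B : 'M[K]_(n, n.+1) := \matrix_(i, l) L l (v i).
have AB : A *m B = 1%:M.
  apply/matrixP => k l; rewrite !mxE -val_eqE/= -Le ea scalar_sum//.
  by apply: eq_bigr => i _; rewrite !mxE.
have := mxrankM_maxl A B; rewrite AB mxrank1 => /leq_trans/(_ (rank_leq_col A)).
by rewrite ltnn.
Qed.

(** Induction on m: the kernel of the last functional is spanned by the induction
    hypothesis, and one more vector is enough to span S over it. *)
Lemma finitely_spanned_separated m L S : (forall i, scalar (L i)) ->
  submod_closed S ->
  (forall x, x \in S -> (forall i, (i < m)%N -> L i x = 0) -> x = 0) ->
  finitely_spanned S.
Proof.
move=> Ll; elim: m S => [|m IH] S [S0 SZ] Sinj.
  exists 0%N, (fun=> 0); split=> [[]//|x xS]; exists (fun=> 0).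
  by rewrite big_ord0; exact: Sinj.
have L0 i : L i 0 = 0.
  by have := Ll i (-1) 0 0; rewrite scaler0 addr0 mulN1r addNr.
pose S' : {pred V} := [pred x | (x \in S) && (L m x == 0)].
have [|x|n [v [vS' S'v]]] := IH S'.
- split; first by rewrite inE S0 L0/=.
  move=> l x y; rewrite !inE => /andP[xS /eqP x0] /andP[yS /eqP y0].
  by rewrite SZ// Ll x0 y0 mulr0 addr0/=.
- rewrite inE => /andP[xS /eqP x0] xm; apply: Sinj => // i.
  by rewrite ltnS leq_eqVlt => /predU1P[->//|]; exact: xm.
have vS i : v i \in S by have := vS' i; rewrite inE => /andP[].
have [[e [eS e0]]|noe] := pselect (exists e, e \in S /\ L m e != 0); last first.
  exists n, v; split=> // x xS; apply: S'v; rewrite inE xS/=.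
  by apply/negPn/negP => x0; apply: noe; exists x.
exists n.+1, (fun i => oapp v e (unlift ord0 i)); split=> [i|x xS].
  by case: unliftP => [j|] _ /=.
pose c := L m x / L m e.
have [|a xa] := S'v (- c *: e + x).
  by rewrite inE SZ//= Ll mulNr divfK// addNr.
exists (fun i => oapp a c (unlift ord0 i)); rewrite big_ord_recl/= unlift_none/=.
under eq_bigr do rewrite liftK/=.
by rewrite -xa scaleNr addNKr.
Qed.

Lemma infdim_vanishing (W : closed_infdim_subspace V) m L :
  (forall i, scalar (L i)) ->
  exists w, [/\ w \in W, w != 0 & forall i, (i < m)%N -> L i w = 0].
Proof.
move=> Ll; apply: contrapT => noW; apply: (@subspace_infinite _ _ _ W).
apply: (finitely_spanned_separated (m := m) Ll (subspace_submod W)) => x xW x0.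
by apply/eqP/negPn/negP => xn0; apply: noW; exists x.
Qed.

End FiniteDimension.

(** * Partial sums in l_p, and isomorphisms from two-sided bounds *)

Section LpNorm.
Context {R : realType} {F : scalar_kind} {p : R} (p1 : 1 <= p).
Local Notation K := (scalars R F).
Implicit Types x : nat -> K.

Let p0 : 0 < p. Proof. exact: lt_le_trans p1. Qed.

Lemma lp_enorm_le x r : 0 <= r -> (forall m, powsum p m x <= r `^ p) ->
  (lp_enorm p x <= r%:E)%E.
Proof.
move=> r0 xr; rewrite lp_enormE//.
have a0 n : (0 <= (rnorm (x n) `^ p)%:E)%E by rewrite lee_fin powR_ge0.
have s0 : (0 <= \sum_(n <oo) (rnorm (x n) `^ p)%:E)%E by exact: nneseries_ge0.
have -> : r = (r `^ p) `^ p^-1 by rewrite -powRrM divff ?gt_eqF// powRr1.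
rewrite -poweR_EFin gt0_ler_poweR ?invr_ge0 ?(ltW p0)//.
- by rewrite in_itv/= s0 leey.
- by rewrite in_itv/= lee_fin powR_ge0 leey.
apply: lime_le; first exact: is_cvg_nneseries.
by apply: nearW => m; rewrite sumEFin lee_fin big_mkord xr.
Qed.

Lemma powsum_le_rnorm (x : lp F p1) m : powsum p m x <= rnorm x `^ p.
Proof.
rewrite -lee_fin /rnorm lp_normrE of_realK -poweR_EFin lp_normE lp_enormE//.
have a0 n : (0 <= (rnorm (x n) `^ p)%:E)%E by rewrite lee_fin powR_ge0.
rewrite -poweRrM mulVf ?gt_eqF// poweRe1 ?nneseries_ge0//.
rewrite /powsum -sumEFin -(big_mkord xpredT (fun n => (rnorm (x n) `^ p)%:E)).
exact: nneseries_lim_ge.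
Qed.

Lemma lp_powsum_bounded x r : 0 <= r -> (forall m, powsum p m x <= r `^ p) ->
  x \in lp_pred p1.
Proof. by move=> r0 /(lp_enorm_le r0) xr; rewrite lp_predE (le_lt_trans xr) ?ltry. Qed.

Lemma lp_rnorm_le (x : lp F p1) r : 0 <= r ->
  (forall m, powsum p m x <= r `^ p) -> rnorm x <= r.
Proof.
move=> r0 /(lp_enorm_le r0) xr.
by rewrite /rnorm lp_normrE of_realK -lee_fin lp_normE.
Qed.

Lemma lp_ext (x y : lp F p1) : lp_seq x =1 lp_seq y -> x = y.
Proof. by move=> xy; apply: val_inj; apply/funext. Qed.

Lemma lp_linE (l : K) (x y : lp F p1) n : (l *: x + y) n = l * x n + y n.
Proof. by []. Qed.

End LpNorm.

Section Isomorphism.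
Context {R : realType} {F : scalar_kind}.
Local Notation K := (scalars R F).

Lemma isomorphic_of_bounds (V W : normedModType K) (f : {linear V -> W})
    (g : W -> V) C D : cancel f g -> cancel g f ->
  (forall v, rnorm (f v) <= C * rnorm v) ->
  (forall v, rnorm v <= D * rnorm (f v)) -> isomorphic V W.
Proof.
move=> fg gf fC fD; exists f, g; split=> //.
  by apply: (lipschitz_rnorm_continuous (C := C)) => v w; rewrite -linearB.
apply: (lipschitz_rnorm_continuous (C := D)) => v w.
by rewrite (le_trans (fD _))// linearB !gf.
Qed.

End Isomorphism.

(** * The subspace and the quotient *)

Section KaltonPeckExtension.
Context {R : realType} {F : scalar_kind} {p : R} (p1 : 1 < p).
Local Notation K := (scalars R F).
Local Notation ofR := (@of_real R F).
Local Notation Z := (kalton_peck F p1).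
Local Notation q := (conjexp p).
Implicit Types z w : Z.

Let p0 : 0 < p. Proof. exact: lt_trans p1. Qed.

Lemma kp_bounded_embed (x : nat -> K) r : 0 < r -> (forall m, powsum p m x <= r `^ p) ->
  kp_bounded p (x, 0) r.
Proof. by move=> r0 xr m b b1; rewrite kp_form_fst// (pairing_le p1). Qed.

Lemma kp_bounded_lift (y : nat -> K) : (forall m, powsum p m y <= 1) ->
  kp_bounded p (kp_lift p y) p.
Proof. by move=> y1 m b b1; rewrite kp_form_lift_le. Qed.

Lemma mem_kp_pred v M : kp_bounded p v M -> v \in kp_pred (F := F) p1.
Proof. by move=> vM; apply/asboolP; exists M. Qed.

Lemma kp_fst_powsum z m : z.2 = 0 -> powsum p m z.1 <= rnorm z `^ p.
Proof.
move=> z2; apply: (powsum_duality p1) => [|b b1]; first exact: rnorm_ge0.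
by rewrite -kp_form_fst// kp_form_le.
Qed.

Lemma kp_snd_powsum z m : powsum p m z.2 <= ((expR 1 + 1) * rnorm z) `^ p.
Proof.
have c0 : 0 <= expR 1 + 1 :> R by rewrite addr_ge0 ?expR_ge0.
apply: (powsum_duality p1) => [|b b1]; first by rewrite mulr_ge0 ?rnorm_ge0.
by apply: (kp_pairing_le p1) b1 => c c1; exact: kp_form_le.
Qed.

Lemma kp_fst_scalar n : scalar (fun z : Z => z.1 n).
Proof. by []. Qed.

Lemma kp_snd_scalar n : scalar (fun z : Z => z.2 n).
Proof. by []. Qed.

Definition kp_kernel_pred : {pred Z} := [pred z : Z | `[< z.2 = 0 >]].

Lemma kp_kernelP z : reflect (z.2 = 0) (z \in kp_kernel_pred).
Proof. exact: asboolP. Qed.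

Lemma kp_kernel_submod : submod_closed kp_kernel_pred.
Proof.
split=> [|l z w]; first exact/kp_kernelP.
move=> /kp_kernelP z0 /kp_kernelP w0; apply/kp_kernelP.
by rewrite /= z0 w0 scaler0 addr0.
Qed.

Lemma kp_kernel_closed : closed [set z | z \in kp_kernel_pred].
Proof.
move=> z clz; apply/kp_kernelP/funext => n; apply: rnorm0_eq0; apply/eqP.
rewrite eq_le rnorm_ge0 andbT; apply/ler_addgt0Pr => e e0; rewrite add0r.
have c0 : 0 < expR 1 + 1 :> R by rewrite addr_gt0 ?expR_gt0.
have [|w [/= /kp_kernelP w0 /ball_rnorm zw]] := clz (ball z (ofR ((expR 1 + 1)^-1 * e))).
  by apply: nbhsx_ballx; rewrite of_real_gt0 mulr_gt0// invr_gt0.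
have := kp_snd_lipschitz n z w; rewrite w0 subr0 => /le_trans; apply.
by rewrite -ler_pdivlMl// ltW.
Qed.

Lemma kp_embed_subproof (x : lp F (ltW p1)) : (lp_seq x, 0) \in kp_pred (F := F) p1.
Proof.
apply: (@mem_kp_pred _ (rnorm x + 1)); apply: kp_bounded_embed => [|m].
  by rewrite ltr_wpDl ?rnorm_ge0.
rewrite (le_trans (powsum_le_rnorm _ _))// ge0_ler_powR ?(ltW p0)//.
- by rewrite nnegrE rnorm_ge0.
- by rewrite nnegrE addr_ge0 ?rnorm_ge0.
- by rewrite lerDl.
Qed.

Definition kp_embed (x : lp F (ltW p1)) : Z := KaltonPeck (kp_embed_subproof x).

Lemma kp_embed_rnorm_le (x : lp F (ltW p1)) : rnorm (kp_embed x) <= rnorm x.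
Proof.
apply/ler_addgt0Pr => e e0; apply: kp_rnorm_le.
have xe0 : 0 < rnorm x + e by rewrite ltr_wpDl ?rnorm_ge0.
apply: kp_bounded_embed => // m.
rewrite (le_trans (powsum_le_rnorm _ _))// ge0_ler_powR ?(ltW p0)//.
- by rewrite nnegrE rnorm_ge0.
- by rewrite nnegrE ltW.
- by rewrite lerDl ltW.
Qed.

Lemma delta_seq_lp n : delta_seq (F := F) n \in lp_pred (ltW p1).
Proof.
apply: (@lp_powsum_bounded _ _ _ _ _ 1) => // m.
rewrite powR1; apply: le_trans (le_powsum p _ (leq_addr n.+1 m)) _.
rewrite -(@powsum_delta R F p n) ?gt_eqF//.
elim: m => [//|m IH]; rewrite addSn powsumS /delta_seq.
by rewrite gtn_eqF ?rnorm0 ?powR0 ?gt_eqF ?addr0// addnS ltnS leq_addl.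
Qed.

Lemma kp_kernel_infinite : ~ finitely_spanned kp_kernel_pred.
Proof.
apply: (@not_finitely_spanned _ _ _ _ (fun n => kp_embed (Lp (delta_seq_lp n)))
  (fun n z => z.1 n)) => [|n|i j] //.
- exact/kp_kernelP.
- by rewrite /= /delta_seq eq_sym.
Qed.

Definition kp_kernel : closed_infdim_subspace Z :=
  ClosedInfdimSubspace kp_kernel_submod kp_kernel_closed kp_kernel_infinite.

Section Kernel.
Local Notation X := (subspace_type kp_kernel).

Lemma kernel_fst_subproof (z : X) : (subspace_val z).1 \in lp_pred (ltW p1).
Proof.
apply: (lp_powsum_bounded (ltW p1) (rnorm_ge0 (subspace_val z))) => m.
exact/kp_fst_powsum/kp_kernelP/subspace_valP.
Qed.

Definition kernel_fst (z : X) : lp F (ltW p1) := Lp (kernel_fst_subproof z).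

Lemma kernel_fstE (z : X) n : kernel_fst z n = (subspace_val z).1 n.
Proof. by []. Qed.

Lemma kernel_fst_linear : linear kernel_fst.
Proof.
move=> l z w; apply: lp_ext => n; rewrite [RHS]lp_linE.
rewrite kernel_fstE (kernel_fstE z) (kernel_fstE w).
by have -> : subspace_val (l *: z + w) = l *: subspace_val z + subspace_val w by [].
Qed.

HB.instance Definition _ :=
  GRing.isLinear.Build K X (lp F (ltW p1)) *:%R kernel_fst kernel_fst_linear.

Lemma kp_embed_kernel (x : lp F (ltW p1)) : kp_embed x \in kp_kernel.
Proof. exact/kp_kernelP. Qed.

Lemma kernel_isomorphic : isomorphic X (lp F (ltW p1)).
Proof.
apply: (@isomorphic_of_bounds R F X (lp F (ltW p1)) kernel_fst
  (fun x => SubspaceElt (kp_embed_kernel x)) 1 1) => [z|x|z|z].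
- apply: val_inj; apply: kp_ext => //=.
  by apply/esym/kp_kernelP; exact: subspace_valP.
- by apply: lp_ext.
- rewrite mul1r; apply: lp_rnorm_le; first exact: rnorm_ge0.
  by move=> m; exact/kp_fst_powsum/kp_kernelP/subspace_valP.
- rewrite mul1r; apply: le_trans (kp_embed_rnorm_le (kernel_fst z)).
  have <- : subspace_val z = kp_embed (kernel_fst z).
    by apply: kp_ext => //=; apply/kp_kernelP; exact: subspace_valP.
  by rewrite /rnorm subspace_normrE.
Qed.

End Kernel.

Section Quotient.
Local Notation Q := (quotient_space kp_kernel).
Local Notation pi := (@quotient_proj _ _ _ kp_kernel).

Lemma quotient_snd_subproof (u : Q) : (repr u).2 \in lp_pred (ltW p1).
Proof.
by apply: (lp_powsum_bounded (ltW p1) _ (kp_snd_powsum (repr u)));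
  rewrite mulr_ge0 ?rnorm_ge0 ?addr_ge0 ?expR_ge0.
Qed.

Definition quotient_snd (u : Q) : lp F (ltW p1) := Lp (quotient_snd_subproof u).

Lemma quotient_sndE z : quotient_snd (pi z) = z.2 :> (nat -> K).
Proof.
have /eq_quotient_proj/kp_kernelP/= := quotient_projK (pi z).
by move/eqP; rewrite subr_eq0 => /eqP.
Qed.

Lemma quotient_snd_linear : linear quotient_snd.
Proof.
move=> l u v; apply: lp_ext => n; rewrite [RHS]lp_linE.
rewrite -(quotient_projK u) -(quotient_projK v) -quotient_projZ -quotient_projD.
by rewrite !quotient_sndE.
Qed.

HB.instance Definition _ :=
  GRing.isLinear.Build K Q (lp F (ltW p1)) *:%R quotient_snd quotient_snd_linear.

Lemma quotient_snd_inj u : quotient_snd u = 0 -> u = 0.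
Proof.
move=> u0; rewrite -(quotient_projK u) -(quotient_proj0 kp_kernel).
apply/eq_quotient_proj; rewrite subr0; apply/kp_kernelP.
exact: (congr1 val u0).
Qed.

Lemma powsum_normalized (y : lp F (ltW p1)) m :
  powsum p m (ofR (rnorm y)^-1 *: y) <= 1.
Proof.
have [->|y0] := eqVneq y 0.
  by rewrite rnorm0 invr0 of_real0 scale0r (le_trans (powsum_le_rnorm _ _))// rnorm0 powR0 ?gt_eqF.
rewrite (le_trans (powsum_le_rnorm _ _))// rnormZr.
rewrite gtr0_norm ?invr_gt0 ?rnorm_gt0// mulVf ?powR1//.
by rewrite gt_eqF ?rnorm_gt0.
Qed.

(** The lift is not homogeneous because of the logarithm, so it is applied to the
    normalized sequence and scaled back.  At y = 0 the inverse of the norm is 0 and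
    the value is 0. *)
Definition lp_section (y : lp F (ltW p1)) : Z :=
  ofR (rnorm y) *: KaltonPeck (mem_kp_pred (kp_bounded_lift (powsum_normalized y))).

Lemma lp_section_snd (y : lp F (ltW p1)) : (lp_section y).2 = y.
Proof.
rewrite /= -[RHS]/(val y) -[_ *: _]/(val (ofR (rnorm y) *: (ofR (rnorm y)^-1 *: y))).
congr val; have [->|y0] := eqVneq y 0; first by rewrite !scaler0.
by rewrite scalerA -of_realM divff ?of_real1 ?scale1r// gt_eqF ?rnorm_gt0.
Qed.

Lemma lp_section_rnorm_le (y : lp F (ltW p1)) : rnorm (lp_section y) <= p * rnorm y.
Proof.
rewrite rnormZr ger0_norm ?rnorm_ge0// mulrC ler_wpM2r ?rnorm_ge0//.
exact/kp_rnorm_le/kp_bounded_lift/powsum_normalized.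
Qed.

Lemma quotient_isomorphic : isomorphic Q (lp F (ltW p1)).
Proof.
have c0 : 0 < expR 1 + 1 :> R by rewrite addr_gt0 ?expR_gt0.
have sndK : cancel (pi \o lp_section) quotient_snd.
  by move=> y; apply: lp_ext => n; rewrite quotient_sndE lp_section_snd.
have sndK' : cancel quotient_snd (pi \o lp_section).
  move=> u; apply/eqP; rewrite -subr_eq0; apply/eqP/quotient_snd_inj.
  by rewrite linearB/= sndK subrr.
apply: (@isomorphic_of_bounds R F Q (lp F (ltW p1)) quotient_snd (pi \o lp_section)
  (expR 1 + 1) p) => // u.
  rewrite -ler_pdivrMl// [leRHS]/rnorm quotient_normrE of_realK.
  apply: le_quotient_norm => z zu; rewrite ler_pdivrMl//.
  apply: lp_rnorm_le => [|m]; first by rewrite mulr_ge0 ?rnorm_ge0 ?ltW.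
  by rewrite -zu quotient_sndE kp_snd_powsum.
rewrite -[leLHS]/(rnorm u) -{1}(sndK' u) (le_trans _ (lp_section_rnorm_le _))//.
by rewrite /rnorm quotient_normrE of_realK quotient_norm_le.
Qed.

End Quotient.
End KaltonPeckExtension.

(** * Signs and disjoint blocks *)

(** On average over the signs the off-diagonal terms cancel.  The signs are
    chosen one at a time, each making its own cross terms nonnegative. *)
Lemma exists_signs (R : realType) (a : nat -> nat -> R) J :
  exists2 s : nat -> R, (forall i, `|s i| = 1) &
    \sum_(i < J) a i i <= \sum_(i < J) \sum_(j < J) s i * s j * a i j.
Proof.
elim: J => [|J [s s1 IH]]; first by exists (fun=> 1) => [i|]; rewrite ?normr1 ?big_ord0.
pose u := \sum_(i < J) s i * (a i J + a J i).
pose t : R := if 0 <= u then 1 else -1.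
have t1 : `|t| = 1 by rewrite /t; case: ifP; rewrite ?normrN normr1.
have tu : 0 <= t * u.
  rewrite /t; case: ifPn => [u0|]; first by rewrite mul1r.
  by rewrite -ltNge mulN1r oppr_ge0 => /ltW.
pose s' i := if i == J then t else s i.
have s'lt (i : 'I_J) : s' i = s i by rewrite /s' ltn_eqF.
have s'J : s' J = t by rewrite /s' eqxx.
exists s' => [i|]; first by rewrite /s'; case: ifP.
rewrite !big_ord_recr/= s'J -expr2 -real_normK ?num_real// t1 expr1n mul1r.
have -> : \sum_(i < J) \sum_(j < J.+1) s' i * s' j * a i j =
    \sum_(i < J) \sum_(j < J) s i * s j * a i j + \sum_(i < J) s i * t * a i J.
  rewrite -big_split; apply: eq_bigr => i _; rewrite big_ord_recr/= s'J s'lt.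
  by congr (_ + _); apply: eq_bigr => j _; rewrite s'lt.
rewrite !addrA lerD2r -addrA (le_trans IH)// lerDl.
suff -> : \sum_(i < J) s i * t * a i J + \sum_(j < J) t * s' j * a J j = t * u by [].
rewrite -big_split/= /u mulr_sumr; apply: eq_bigr => i _; rewrite s'lt; ring.
Qed.

Section Blocks.
Context {R : realType} {F : scalar_kind}.
Local Notation K := (scalars R F).
Local Notation ofR := (@of_real R F).

Definition pairwise_disjoint (w : nat -> nat -> K) :=
  forall i j n, i != j -> w i n = 0 \/ w j n = 0.

Definition block_sum J (a : nat -> K) (w : nat -> nat -> K) : nat -> K :=
  fun n => \sum_(j < J) a j * w j n.

(** At most one of the terms is nonzero, so any function vanishing at 0, linear or
    not, commutes with the sum; it is applied to powers of the modulus and to the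
    Kalton-Peck map. *)
Lemma disjoint_sum (A : zmodType) (phi : K -> A) J (v : nat -> K) :
  phi 0 = 0 -> (forall i j, i != j -> v i = 0 \/ v j = 0) ->
  phi (\sum_(j < J) v j) = \sum_(j < J) phi (v j).
Proof.
move=> phi0 dv; elim: J => [|J IH]; first by rewrite !big_ord0.
rewrite !big_ord_recr/=; have [->|vJ] := eqVneq (v J) 0.
  by rewrite addr0 phi0 addr0.
have v0 (j : 'I_J) : v j = 0.
  have := dv j J; rewrite ltn_eqF// => /(_ isT)[//|/eqP].
  by rewrite (negbTE vJ).
by rewrite !big1 ?add0r// => j _; rewrite v0.
Qed.

Lemma block_sum_phi (A : zmodType) (phi : K -> A) J a w n :
  phi 0 = 0 -> pairwise_disjoint w ->
  phi (block_sum J a w n) = \sum_(j < J) phi (a j * w j n).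
Proof.
move=> phi0 dw; apply: (@disjoint_sum _ phi J (fun j => a j * w j n)) => // i j ij.
by have [->|->] := dw i j n ij; [left|right]; rewrite mulr0.
Qed.

Lemma powsum_block_sum r m J (s : nat -> R) (w : nat -> nat -> K) :
  0 < r -> (0 < J)%N -> (forall i, `|s i| = 1) -> pairwise_disjoint w ->
  (forall j, powsum r m (w j) <= 1) ->
  powsum r m (block_sum J (fun j => ofR (J%:R `^ (- r^-1) * s j)) w) <= 1.
Proof.
move=> r0 J0 s1 dw w1; rewrite /powsum.
under eq_bigr => n _.
  rewrite (@block_sum_phi _ (fun u : K => rnorm u `^ r)) ?rnorm0 ?powR0 ?gt_eqF//.
  over.
have term (j : 'I_J) (n : nat) :
    rnorm (ofR (J%:R `^ (- r^-1) * s j) * w j n) `^ r = J%:R^-1 * rnorm (w j n) `^ r.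
  rewrite rnormM rnorm_of_real normrM s1 mulr1 ger0_norm ?powR_ge0//.
  rewrite powRM ?powR_ge0 ?rnorm_ge0// -powRrM mulNr mulVf ?gt_eqF//.
  by rewrite powR_inv1.
under eq_bigr do under eq_bigr do rewrite term.
rewrite exchange_big/=; under eq_bigr do rewrite -mulr_sumr.
rewrite -mulr_sumr ler_pdivrMl ?ltr0n// mulr1.
apply: (@le_trans _ _ (\sum_(j < J) 1)); first by apply: ler_sum => j _; exact: w1.
by rewrite sumr_const card_ord.
Qed.

Lemma pairing_block_sum m J a w x :
  pairing m (block_sum J a w) x = \sum_(j < J) a j * pairing m (w j) x.
Proof.
rewrite /pairing /block_sum; under eq_bigr do rewrite mulr_suml.
rewrite exchange_big; apply: eq_bigr => j _; rewrite mulr_sumr.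
by apply: eq_bigr => n _; rewrite mulrA.
Qed.

End Blocks.

(** * The logarithmic obstruction *)

Section NoProjection.
Context {R : realType} {F : scalar_kind} {p : R} (p1 : 1 < p).
Local Notation K := (scalars R F).
Local Notation ofR := (@of_real R F).
Local Notation Z := (kalton_peck F p1).
Local Notation q := (conjexp p).

Let p0 : 0 < p. Proof. exact: lt_trans p1. Qed.
Let q0 : 0 < q. Proof. exact: conjexp_gt0. Qed.

(** Since ln|c w| = ln c + ln|w|, scaling the blocks by c displaces the lift by the
    multiple (p - 1) ln c of the blocks placed in the first component; this
    displacement is what no bounded projection can undo. *)
Lemma kp_lift_block_sum J (s : nat -> R) (w : nat -> nat -> K) (E G : nat -> Z)
    (Y : Z) (c : R) :
  (0 < c) -> (forall i, `|s i| = 1) -> pairwise_disjoint w ->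
  (forall j, kp_val (E j) = (w j, 0)) ->
  (forall j, kp_val (G j) = kp_lift p (w j)) ->
  kp_val Y = kp_lift p (block_sum J (fun j => ofR (c * s j)) w) ->
  Y = \sum_(j < J) ofR (c * s j) *: (G j + ofR ((p - 1) * ln c) *: E j).
Proof.
move=> c0 s1 dw Ew Gw Yw; set d := (p - 1) * ln c.
apply: kp_ext; apply/funext => n.
  have GE (j : nat) : (G j + ofR d *: E j).1 n =
      ofR ((p - 1) * ln (rnorm (w j n))) * w j n + ofR d * w j n.
    by transitivity ((G j).1 n + ofR d * (E j).1 n) => //; rewrite Gw Ew.
  rewrite (scalar_sum (fun j => ofR (c * s j)) (fun j => G j + ofR d *: E j)
    (@kp_fst_scalar R F p p1 n)).
  under eq_bigr do rewrite GE.
  rewrite Yw/=.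
  rewrite (@block_sum_phi _ _ _ (fun u : K => ofR ((p - 1) * ln (rnorm u)) * u)) ?mulr0//.
  apply: eq_bigr => j _.
  have [->|wj] := eqVneq (w j n) 0; first by rewrite !mulr0 addr0 mulr0.
  rewrite !rnormM rnorm_of_real normrM s1 mulr1 (gtr0_norm c0).
  rewrite lnM ?posrE ?rnorm_gt0// mulrDr of_realD -/d; ring.
have GE (j : nat) : (G j + ofR d *: E j).2 n = w j n.
  transitivity ((G j).2 n + ofR d * (E j).2 n) => //.
  by rewrite Gw Ew/= mulr0 addr0.
rewrite (scalar_sum (fun j => ofR (c * s j)) (fun j => G j + ofR d *: E j)
  (@kp_snd_scalar R F p p1 n)).
by under eq_bigr do rewrite GE; rewrite Yw.
Qed.

End NoProjection.

Section LogBound.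
Context {R : realType} {F : scalar_kind} {p : R} (p1 : 1 < p).
Local Notation K := (scalars R F).
Local Notation ofR := (@of_real R F).
Local Notation Z := (kalton_peck F p1).
Local Notation q := (conjexp p).

Let p0 : 0 < p. Proof. exact: lt_trans p1. Qed.
Let q0 : 0 < q. Proof. exact: conjexp_gt0. Qed.

Lemma rnorm_pairing_kernel_le m (b : nat -> K) (z : Z) :
  powsum q m b <= 1 -> z.2 = 0 -> rnorm (pairing m b z.1) <= rnorm z.
Proof. by move=> b1 z0; rewrite -kp_form_fst// kp_form_le. Qed.

(** T plays the role of a projection, E j of the block w j placed in the first
    component, and the last hypothesis says that T keeps a definite part of each
    block.  The two normalizations J^(-1/p) of the blocks and J^(-1/q) of their
    duals multiply to J^(-1), so the bilinear form averages the J diagonal terms,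
    each of which contains the logarithm. *)
Lemma log_le_of_diagonal (T : {linear Z -> Z}) (C : R) M J (w : nat -> nat -> K)
    (E : nat -> Z) : (0 < J)%N -> 0 <= C ->
  (forall z, (T z).2 = 0) -> (forall z, rnorm (T z) <= C * rnorm z) ->
  pairwise_disjoint w -> (forall m j, powsum p m (w j) <= 1) ->
  (forall j, kp_val (E j) = (w j, 0)) ->
  (forall j, (j < J)%N ->
     4^-1 <= to_real (pairing M (dual p (w j)) (T (E j)).1)) ->
  (p - 1) / p * ln J%:R <= 8 * (C * p).
Proof.
move=> J0 C0 T2 TC dw w1 Ew Tw.
have J0' : (0 : R) < J%:R by rewrite ltr0n.
pose c : R := J%:R `^ (- p^-1); pose d : R := J%:R `^ (- q^-1).
have c0 : 0 < c by rewrite powR_gt0.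
have cd : d * c = J%:R^-1.
  rewrite -powRD ?(gt_eqF J0') ?implybT// -opprD addrC conjexp_inv//.
  by rewrite powR_inv1 ?ltW.
set kappa := (p - 1) / p * ln J%:R.
have kappaE : (p - 1) * ln c = - kappa by rewrite ln_powR /kappa; ring.
pose G j : Z := KaltonPeck (mem_kp_pred p1 (kp_bounded_lift p1 (fun m => w1 m j))).
pose b j := dual p (w j).
have b1 j : powsum q M (b j) <= 1 by rewrite powsum_dual.
have db : pairwise_disjoint b.
  by move=> i j n ij; have [?|?] := dw i j n ij; [left|right]; exact: dual_eq0.
pose H j := G j + ofR ((p - 1) * ln c) *: E j.
pose L j z := pairing M (b j) (T z).1.
have LD j z z' : L j (z + z') = L j z + L j z'.
  rewrite /L linearD -[(T z + T z').1]/((T z).1 + (T z').1).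
  by have := pairing_scalar M (b j) 1 (T z).1 (T z').1; rewrite scale1r mul1r.
have LZ j l z : L j (l *: z) = l * L j z.
  by rewrite /L linearZ -[(l *: T z).1]/(l *: (T z).1) pairingZr.
have Ls j : scalar (L j) by move=> l z z'; rewrite LD LZ.
have L_le j z : rnorm (L j z) <= C * rnorm z.
  by rewrite (le_trans _ (TC z))// rnorm_pairing_kernel_le.
pose A i j := - to_real (L i (H j)).
have Ajj j : (j < J)%N -> kappa / 4 - C * p <= A j j.
  move=> jJ; rewrite /A /H LD LZ to_realD to_realZ kappaE.
  have G_le : to_real (L j (G j)) <= C * p.
    rewrite (le_trans (ler_norm _))// (le_trans (to_real_le_rnorm _))//.
    rewrite (le_trans (L_le _ _))// ler_wpM2l// kp_rnorm_le//.
    by apply: (kp_bounded_lift p1) => m; exact: w1.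
  rewrite opprD mulNr opprK addrC lerD ?lerN2// ler_wpM2l ?Tw//.
  by rewrite /kappa mulr_ge0 ?ln_ge0 ?ler1n// divr_ge0// ltW// subr_gt0.
have [s s1 sA] := exists_signs A J.
pose y := block_sum J (fun j => ofR (c * s j)) w.
have y1 m : powsum p m y <= 1 by exact: powsum_block_sum.
pose Y : Z := KaltonPeck (mem_kp_pred p1 (kp_bounded_lift p1 y1)).
have YE : Y = \sum_(j < J) ofR (c * s j) *: H j.
  exact: (kp_lift_block_sum c0 s1 dw Ew (G := G)).
pose B := block_sum J (fun j => ofR (d * s j)) b.
have B1 : powsum q M B <= 1 by exact: powsum_block_sum.
have BY_le : - to_real (pairing M B (T Y).1) <= C * p.
  rewrite (le_trans (ler_norm _))// normrN (le_trans (to_real_le_rnorm _))//.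
  rewrite (le_trans (rnorm_pairing_kernel_le B1 (T2 Y)))// (le_trans (TC _))//.
  by rewrite ler_wpM2l// kp_rnorm_le//; exact: kp_bounded_lift.
have BYE : - to_real (pairing M B (T Y).1) =
    J%:R^-1 * \sum_(i < J) \sum_(j < J) s i * s j * A i j.
  rewrite pairing_block_sum (to_real_sum J (fun i => ofR (d * s i) * L i Y)).
  rewrite -sumrN mulr_sumr; apply: eq_bigr => i _.
  rewrite YE (scalar_sum (fun j => ofR (c * s j)) H (Ls i)) to_realZ.
  rewrite (to_real_sum J (fun j => ofR (c * s j) * L i (H j))).
  rewrite !mulr_sumr -sumrN; apply: eq_bigr => j _.
  by rewrite to_realZ /A -cd; ring.
have : kappa / 4 - C * p <= C * p.
  rewrite (le_trans _ BY_le)// BYE ler_pdivlMl// (le_trans _ sA)//.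
  rewrite mulr_natl -[X in _ *+ X]card_ord -sumr_const; apply: ler_sum => j _.
  exact: Ajj.
by move: (C * p) => X h; lra.
Qed.

End LogBound.

(** * Gliding hump and conclusion *)

Section GlidingHump.
Context {R : realType} {F : scalar_kind} {p : R} (p1 : 1 < p).
Local Notation K := (scalars R F).
Local Notation ofR := (@of_real R F).
Local Notation Z := (kalton_peck F p1).

Let p0 : 0 < p. Proof. exact: lt_trans p1. Qed.

Definition truncation k (x : nat -> K) : nat -> K :=
  fun n => if (n < k)%N then x n else 0.

Lemma powsum_truncationD k m (x : nat -> K) :
  powsum p m x = powsum p m (truncation k x) + powsum p m (x - truncation k x).
Proof.
rewrite /powsum -big_split; apply: eq_bigr => n _ /=.
rewrite -[(x - _) n]/(x n - truncation k x n) /truncation.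
by case: ifP => _; rewrite ?subrr ?subr0 rnorm0 powR0 ?gt_eqF ?addr0 ?add0r.
Qed.

Lemma powsum_truncation k (x : nat -> K) :
  powsum p k (truncation k x) = powsum p k x.
Proof. by apply: eq_bigr => n _; rewrite /truncation ltn_ord. Qed.

(** An infinite dimensional W contains a nonzero vector vanishing on the first m
    coordinates; it is scaled to l_p norm 1 and cut where its tail is small. *)
Lemma gliding_hump (W : closed_infdim_subspace Z) (d : R) m :
  {subset W <= kp_kernel p1} -> 0 < d ->
  exists (k : nat) (z : Z) (w : nat -> K),
    [/\ z \in W, forall n, w n != 0 -> (m <= n < k)%N /\ w n = z.1 n,
        forall l, powsum p l w <= 1, 2^-1 <= powsum p k w &
        forall l, powsum p l (z.1 - w) <= d `^ p].
Proof.
move=> WX d0.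
have [v [vW v0 vm]] := infdim_vanishing W m (fun i => @kp_fst_scalar R F p p1 i).
have /kp_kernelP v2 := WX _ vW.
have [n vn] : exists n, v.1 n != 0.
  apply: contrapT => nv; move/eqP: v0; apply; apply: kp_ext => //.
  by apply/funext => n; apply/eqP/negPn/negP => vn; apply: nv; exists n.
pose A := range (fun l => powsum p l v.1).
have supA : has_sup A.
  split; first by exists (powsum p 0 v.1), 0%N.
  by exists (rnorm v `^ p) => _ [l _ <-]; exact: kp_fst_powsum.
pose S := sup A.
have leS l : powsum p l v.1 <= S by apply: ub_le_sup; [case: supA|exists l].
have S0 : 0 < S.
  apply: lt_le_trans (leS n.+1); rewrite powsumS ltr_wpDl ?powsum_ge0//.
  by rewrite powR_gt0// rnorm_gt0.
(* Half of the mass must remain in the block, and the tail must be below d^p. *)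
pose eta := Num.min 2^-1 (d `^ p).
have eta0 : 0 < eta by rewrite lt_min powR_gt0// andbT invr_gt0.
have [_ [k _ <-] Sk] := sup_adherent (mulr_gt0 S0 eta0) supA.
pose c : R := S `^ (- p^-1).
have cp : c `^ p = S^-1 by rewrite -powRrM mulNr mulVf ?gt_eqF// powR_inv1 ?ltW.
pose z : Z := ofR c *: v.
have zE l : powsum p l z.1 = S^-1 * powsum p l v.1.
  by rewrite -[z.1]/(ofR c *: v.1) powsumZ rnorm_of_real ger0_norm ?powR_ge0// cp.
have z1 l : powsum p l z.1 <= 1 by rewrite zE ler_pdivrMl// mulr1.
have zk : 1 - eta <= powsum p k z.1.
  by rewrite zE ler_pdivlMl// mulrBr mulr1 ltW.
pose w := truncation k z.1.
have wk : 1 - eta <= powsum p k w by rewrite powsum_truncation.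
exists k, z, w; split.
- by rewrite /z rpredZ.
- move=> i; rewrite /w /truncation; case: ifPn => ik; last by rewrite eqxx.
  move=> zi; split=> //; rewrite andbT leqNgt; apply: contra_neqN zi => im.
  by rewrite -[z.1 i]/(ofR c * v.1 i) vm// mulr0.
- by move=> l; rewrite (le_trans _ (z1 l))// [leRHS](powsum_truncationD k) lerDl powsum_ge0.
- apply: le_trans wk; suff : eta <= 2^-1 by lra.
  by rewrite /eta ge_min lexx.
- move=> l; apply: le_trans (le_powsum p _ (leq_addr k l)) _.
  apply: (@le_trans _ _ eta); last by rewrite /eta ge_min lexx orbT.
  have := z1 (l + k)%N; rewrite (powsum_truncationD k) -/w.
  have := le_powsum p w (leq_addl l k); lra.
Qed.

Lemma hump_sequence (W : closed_infdim_subspace Z) (d : R) :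
  {subset W <= kp_kernel p1} -> 0 < d ->
  exists (N : nat -> nat) (z : nat -> Z) (w : nat -> nat -> K),
    [/\ {homo N : i j / (i <= j)%N},
        forall j, z j \in W,
        forall j n, w j n != 0 -> (N j <= n < N j.+1)%N /\ w j n = (z j).1 n,
        forall m j, powsum p m (w j) <= 1 &
        forall j, 2^-1 <= powsum p (N j.+1) (w j) /\
          forall m, powsum p m ((z j).1 - w j) <= d `^ p].
Proof.
move=> WX d0.
have hump m : exists t : nat * Z * (nat -> K),
    [/\ t.1.2 \in W, forall n, t.2 n != 0 -> (m <= n < t.1.1)%N /\ t.2 n = t.1.2.1 n,
        forall l, powsum p l t.2 <= 1, 2^-1 <= powsum p t.1.1 t.2 &
        forall l, powsum p l (t.1.2.1 - t.2) <= d `^ p].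
  by have [k [z [w ?]]] := gliding_hump m WX d0; exists (k, z, w).
have {hump}[t ht] := choice hump.
pose N := fix N j := if j is j'.+1 then (t (N j')).1.1 else 0%N.
have NS j : (N j <= N j.+1)%N.
  have [_ tw _ thalf _] := ht (N j); rewrite leqNgt; apply/negP => NSN.
  have : powsum p (N j.+1) (t (N j)).2 = 0.
    rewrite /powsum big1// => n _.
    have [->|/tw[/andP[Nn _] _]] := eqVneq ((t (N j)).2 n) 0.
      by rewrite rnorm0 powR0 ?gt_eqF.
    by have := leq_ltn_trans Nn (ltn_trans (ltn_ord n) NSN); rewrite ltnn.
  by move: thalf; rewrite /= => /[swap] ->; lra.
exists N, (fun j => (t (N j)).1.2), (fun j => (t (N j)).2); split.
- apply: homo_leq => [//|y x z|]; [exact: leq_trans|exact: NS].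
- by move=> j; have [] := ht (N j).
- by move=> j; have [] := ht (N j).
- by move=> m j; have [] := ht (N j).
- by move=> j; have [] := ht (N j).
Qed.

(** If W were complemented, the projection would move the blocks only slightly,
    because they are close to W, and the bound of [log_le_of_diagonal] would hold
    for every J. *)
Lemma not_complemented_sub_kernel (W : closed_infdim_subspace Z) :
  {subset W <= kp_kernel p1} -> ~ complemented W.
Proof.
move=> WX [P [Pc PW PK]].
have [C C0 PC] := continuous_rnorm_bounded Pc.
(* An error d between w j and W costs at most C d <= 1/4 after projecting, out
   of a diagonal term that is at least 1/2. *)
pose d : R := (4 * (C + 1))^-1.
have d0 : 0 < d by rewrite invr_gt0 mulr_gt0// ltr_wpDl.
have [N [z [w [Nle zW wz w1 wd]]]] := hump_sequence WX d0.
have P2 u : (P u).2 = 0 by apply/kp_kernelP/WX/PW.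
have bE j : kp_bounded p (w j, 0) 1.
  by apply: (kp_bounded_embed p1) => // m; rewrite powR1.
pose E j : Z := KaltonPeck (mem_kp_pred p1 (bE j)).
have dw : pairwise_disjoint w.
  suff lt i j n : (i < j)%N -> w i n = 0 \/ w j n = 0.
    move=> i j n; rewrite neq_ltn => /orP[/lt//|/lt]; rewrite or_comm; exact.
  move=> ij; have [->|/wz[/andP[_ nN] _]] := eqVneq (w i n) 0; first by left.
  have [->|/wz[/andP[Nn _] _]] := eqVneq (w j n) 0; first by right.
  by have := leq_trans nN (leq_trans (Nle _ _ ij) Nn); rewrite ltnn.
have zE j : rnorm (z j - E j) <= d.
  apply: kp_rnorm_le; have [_ wdj] := wd j.
  have /kp_kernelP z2 := WX _ (zW j).
  have -> : kp_val (z j - E j) = ((z j).1 - w j, 0).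
    by rewrite [LHS]surjective_pairing/= z2 subr0.
  exact: (kp_bounded_embed p1).
have PE J j : (j < J)%N ->
    4^-1 <= to_real (pairing (N J) (dual p (w j)) (P (E j)).1).
  move=> jJ; pose b := dual p (w j).
  have b1 : powsum (conjexp p) (N J) b <= 1 by rewrite powsum_dual.
  have zw : pairing (N J) b (z j).1 = ofR (powsum p (N J) (w j)).
    rewrite -pairing_dual//; apply: eq_bigr => n _.
    have [w0|/wz[_ ->]//] := eqVneq (w j n) 0.
    by rewrite /b dual_eq0// !mul0r.
  have PEz : (P (E j)).1 = (-1 : K) *: (P (z j - E j)).1 + (z j).1.
    rewrite -[RHS]/((-1 : K) *: P (z j - E j) + z j).1.
    by rewrite linearB (PK (z j))// scaleN1r opprB subrK.
  rewrite PEz pairing_scalar zw mulN1r to_realD to_realN of_realK.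
  have half : 2^-1 <= powsum p (N J) (w j).
    by have [h _] := wd j; rewrite (le_trans h)// le_powsum// Nle.
  have small : to_real (pairing (N J) b (P (z j - E j)).1) <= 4^-1.
    rewrite (le_trans (ler_norm _))// (le_trans (to_real_le_rnorm _))//.
    rewrite (le_trans (rnorm_pairing_kernel_le b1 (P2 _)))// (le_trans (PC _))//.
    rewrite (le_trans (ler_wpM2l C0 (zE j)))//.
    rewrite /d ler_pdivrMr ?mulr_gt0 ?ltr_wpDl// mulrA mulVf// mul1r.
    by rewrite lerDl.
  lra.
have bound J : (0 < J)%N -> (p - 1) / p * ln J%:R <= 8 * (C * p).
  by move=> J0; exact: (log_le_of_diagonal J0 C0 P2 PC dw w1 _ (PE J)).
have k0 : 0 < (p - 1) / p by rewrite divr_gt0// subr_gt0.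
(* Some J exceeds exp B, which contradicts the bound ln J <= B. *)
pose B := ((p - 1) / p)^-1 * (8 * (C * p)).
pose J := (Num.trunc (expR B)).+1.
have := bound J isT; rewrite -ler_pdivlMl// -/B leNgt.
by rewrite -[X in X < _]expRK ltr_ln ?posrE ?expR_gt0 ?ltr0n// truncnS_gt.
Qed.

Lemma kalton_peck_not_subprojective : ~ subprojective Z.
Proof.
move=> /(_ (kp_kernel p1)) [W [WX]]; exact: not_complemented_sub_kernel.
Qed.

End GlidingHump.

Theorem proposition2p7 (R : realType) (F : scalar_kind) (p : R) (p1 : 1 < p) :
  exists (Z : completeNormedModType (scalars R F))
         (X : closed_infdim_subspace Z),
    [/\ ~ subprojective Z,
        isomorphic (subspace_type X) (lp F (ltW p1)) &
        isomorphic (quotient_space X) (lp F (ltW p1))].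
Proof.
exists (kalton_peck F p1), (kp_kernel p1); split.
- exact: kalton_peck_not_subprojective.
- exact: kernel_isomorphic.
- exact: quotient_isomorphic.
Qed.
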